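(* The limit-strategy upper-bound problem under the excess perturbation semantics is undecidable for robust priced timed automata (in the class of robust priced timed games in which every cycle has non-negative accumulated cost) with $5$ clocks, all location prices in $\{0,1\}$, and the cost function of every target location equal to the constant function $0$.
   Context: Clocks are real-valued variables; a valuation is a map $\nu$ from the finite clock set $X$ to $\mathbb{R}_{\ge 0}$, $\nu+t$ adds $t$ to every clock and $\nu[r:=0]$ resets the clocks in $r\subseteq X$ to $0$. A rectangular guard is a finite conjunction of constraints $x\bowtie k$ with $x\in X$, $k\in\mathbb{Z}$, $\bowtie\in\{<,\le,=,>,\ge\}$. A robust priced timed game (RPTG) is a tuple $(L_1,L_2,L_{init},X,E,\eta,T,f_{goal})$: $L_1$ are controller locations, $L_2$ perturbator locations, $L_{init}\subseteq L_1\cup L_2$ initial locations, $E\subseteq L\times \mathrm{Rect}(X)\times 2^X\times (L\cup T)$ transitions (with $L=L_1\cup L_2$), $\eta:L\to\mathbb{Z}$ location prices, $T$ target locations disjoint from $L$, and $f_{goal}$ assigns to each target a piecewise-affine continuous cost function $\mathbb{R}_{\ge0}^{|X|}\to\mathbb{R}\cup\{\pm\infty\}$. A robust priced timed automaton (RPTA) is an RPTG with only controller locations. Excess perturbation semantics for a fixed $\delta>0$: from a state $(l,\nu)$ with $l\in L_1$, the controller chooses a delay $t$ and a transition $e=(l,g,r,l')$ with $\nu+t$ satisfying $g$; the perturbator then chooses $\varepsilon\in[-\delta,\delta]$, the new state is $(l',(\nu+t+\varepsilon)[r:=0])$ and the cost $(t+\varepsilon)\eta(l)$ is incurred (the guard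 is checked before perturbation, the reset and clock update after). From $(l,\nu)$ with $l\in L_2$ the perturbator chooses $t$ and $e=(l,g,r,l')$ with $\nu+t$ satisfying $g$, moving to $(l',(\nu+t)[r:=0])$ with cost $t\,\eta(l)$. Delays at all locations are required to be at least $\delta$. The cost $\mathrm{cost}^\delta$ of a play that first reaches a target $l_n$ with valuation $\nu_n$ is the sum of its transition costs plus $f_{goal}(l_n)(\nu_n)$; a play never reaching a target has cost $+\infty$. Strategies map finite plays to moves of the respective player. The class considered consists of games in which the accumulated cost of every cycle is non-negative. The limit-cost of a controller strategy $\sigma_1$ from state $s$ is $\mathrm{limcost}(s,\sigma_1)=\lim_{\delta\to0}\sup_{\sigma_2}\mathrm{cost}^\delta(\mathrm{outcome}(s,\sigma_1,\sigma_2))$. The limit-strategy upper-bound problem: given such a game, a state $s=(l,\mathbf{0})$ with $l$ initial and accumulated cost $0$, and a rational $K$, decide whether there is a controller strategy $\sigma_1$ with $\mathrm{limcost}(s,\sigma_1)\le K$. *)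

(* Defs.v *)
From HB Require Import structures.
From mathcomp Require Import all_boot all_order all_algebra.
From mathcomp Require Import Rstruct.
Set Implicit Arguments. Unset Strict Implicit. Unset Printing Implicit Defensive.
Import Order.TTheory GRing.Theory Num.Theory.
Local Open Scope ring_scope.

Notation R := Rdefinitions.R.

Inductive code :=
| CZero
| CSucc
| CProj of nat
| CComp of code & list code
| CPrimRec of code & code
| CMu of code.

Inductive eval : code -> seq nat -> nat -> Prop :=
| ev_zero v : eval CZero v 0
| ev_succ x v : eval CSucc (x :: v) x.+1
| ev_proj i v : (i < size v)%N -> eval (CProj i) v (nth 0%N v i)
| ev_comp f gs v ws y : evals gs v ws -> eval f ws y -> eval (CComp f gs) v y
| ev_rec0 f g v y : eval f v y -> eval (CPrimRec f g) (0%N :: v) y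
| ev_recS f g n v y z : eval (CPrimRec f g) (n :: v) y ->
    eval g (n :: y :: v) z -> eval (CPrimRec f g) (n.+1 :: v) z
| ev_mu f v n : eval f (n :: v) 0 ->
    (forall m, (m < n)%N -> exists k, eval f (m :: v) k.+1) -> eval (CMu f) v n
with evals : list code -> seq nat -> seq nat -> Prop :=
| evs_nil v : evals nil v [::]
| evs_cons g gs v w ws : eval g v w -> evals gs v ws -> evals (g :: gs) v (w :: ws).

Definition decides_on {T} (enc : T -> nat) (D P : T -> Prop) (c : code) : Prop :=
  forall x, D x -> (P x -> eval c [:: enc x] 1%N) /\ (~ P x -> eval c [:: enc x] 0%N).

Inductive cmp := CLt | CLe | CEq | CGt | CGe.

Definition cmp_to_ord (c : cmp) : 'I_5 :=
  match c with CLt => inord 0 | CLe => inord 1 | CEq => inord 2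
  | CGt => inord 3 | CGe => inord 4 end.
Definition ord_to_cmp (i : 'I_5) : cmp :=
  match val i with 0 => CLt | 1 => CLe | 2 => CEq | 3 => CGt | _ => CGe end.
Lemma cmp_to_ordK : cancel cmp_to_ord ord_to_cmp.
Proof. by case; rewrite /ord_to_cmp /= inordK. Qed.
HB.instance Definition _ := Countable.copy cmp (can_type cmp_to_ordK).

(* An atomic constraint  x ~ k : (clock index, comparator, integer constant);
   a rectangular guard is a finite conjunction (list) of such constraints. *)
Definition constr := (nat * cmp * int)%type.
Definition guard := seq constr.

(* A transition (l, g, r, l') : source location, guard, reset set,
   destination (inl l' : a location of L, inr j : the j-th target of T). *)
Definition edge := (nat * guard * seq nat * (nat + nat))%type.
Definition e_src (e : edge) : nat := e.1.1.1.
Definition e_guard (e : edge) : guard := e.1.1.2.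
Definition e_reset (e : edge) : seq nat := e.1.2.
Definition e_dst (e : edge) : nat + nat := e.2.

(* An RPTA: (number of clocks, number of locations |L| = |L_1|,
   number of targets |T|, initial locations, prices eta(0..|L|-1), transitions).
   Clocks are 0..nclk-1, locations 0..nloc-1, targets 0..ntgt-1. *)
Definition rpta := (nat * nat * nat * seq nat * seq int * seq edge)%type.
Definition nclk (A : rpta) : nat := A.1.1.1.1.1.
Definition nloc (A : rpta) : nat := A.1.1.1.1.2.
Definition ntgt (A : rpta) : nat := A.1.1.1.2.
Definition inits (A : rpta) : seq nat := A.1.1.2.
Definition prices (A : rpta) : seq int := A.1.2.
Definition edges (A : rpta) : seq edge := A.2.
Definition eta (A : rpta) (l : nat) : int := nth 0 (prices A) l.

Definition wf_edge (A : rpta) (e : edge) : bool :=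
  [&& (e_src e < nloc A)%N,
      all (fun c : constr => (c.1.1 < nclk A)%N) (e_guard e),
      all (fun x => (x < nclk A)%N) (e_reset e) &
      match e_dst e with inl l => (l < nloc A)%N | inr j => (j < ntgt A)%N end].

Definition wf_rpta (A : rpta) : bool :=
  [&& size (prices A) == nloc A,
      all (fun l => (l < nloc A)%N) (inits A) &
      all (wf_edge A) (edges A)].

Definition valuation := nat -> R.
Definition zero_val : valuation := fun _ => 0.

Definition cmp_sat (c : cmp) (a : R) (k : int) : bool :=
  match c with
  | CLt => a < k%:~R | CLe => a <= k%:~R | CEq => a == k%:~R
  | CGt => a > k%:~R | CGe => a >= k%:~R end.

Definition guard_sat (g : guard) (nu : valuation) : bool :=
  all (fun c : constr => cmp_sat c.1.2 (nu c.1.1) c.2) g.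

Definition delay_reset (nu : valuation) (d : R) (r : seq nat) : valuation :=
  fun x => if x \in r then 0 else nu x + d.

Definition state := ((nat + nat) * valuation)%type.

Record step := Step { st_delay : R; st_edge : edge; st_eps : R; st_next : state }.

Definition hist := (state * seq step)%type.
Definition cur (h : hist) : state := last h.1 (map st_next h.2).

Definition ctrl_strat := hist -> R * edge.
Definition pert_strat := hist -> R * edge -> R.

Definition pert_valid (delta : R) (s2 : pert_strat) : Prop :=
  forall h m, - delta <= s2 h m <= delta.

Definition legal (A : rpta) (delta : R) (l : nat) (nu : valuation) (m : R * edge) : bool :=
  [&& delta <= m.1, m.2 \in edges A, e_src m.2 == l & guard_sat (e_guard m.2) (fun x => nu x + m.1)].

(* the prefix of length k of the outcome; None if the controller proposed an
   illegal move (the play is then blocked and never reaches a target);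
   once a target is reached the play stops. *)
Fixpoint run (A : rpta) (delta : R) (s1 : ctrl_strat) (s2 : pert_strat)
    (s0 : state) (k : nat) : option hist :=
  match k with
  | 0 => Some (s0, [::])
  | k'.+1 =>
    match run A delta s1 s2 s0 k' with
    | None => None
    | Some h =>
      match (cur h).1 with
      | inr _ => Some h
      | inl l =>
        let m := s1 h in
        let eps := s2 h m in
        if legal A delta l (cur h).2 m then
          Some (h.1, rcons h.2 (Step m.1 m.2 eps
                 (e_dst m.2, delay_reset (cur h).2 (m.1 + eps) (e_reset m.2))))
        else None
      end
    end
  end.

Definition acc_cost (A : rpta) (h : hist) : R :=
  \sum_(st <- h.2) (st_delay st + st_eps st) * (eta A (e_src (st_edge st)))%:~R.

(* cost^delta(outcome) <= b, where the cost is the accumulated cost plus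
   f_goal at the first target reached, and +oo if no target is reached *)
Definition cost_le (A : rpta) (fgoal : nat -> valuation -> R) (delta : R)
    (s1 : ctrl_strat) (s2 : pert_strat) (s0 : state) (b : R) : Prop :=
  exists k h j, run A delta s1 s2 s0 k = Some h /\ (cur h).1 = inr j /\
    acc_cost A h + fgoal j (cur h).2 <= b.

(* limcost(s0, s1) <= K, i.e. limsup_{delta -> 0+} sup_{s2} cost^delta <= K,
   unfolded: for every e > 0, for all small enough delta > 0, every valid
   perturbator strategy yields cost <= K + e. *)
Definition limcost_le (A : rpta) (fgoal : nat -> valuation -> R)
    (s1 : ctrl_strat) (s0 : state) (K : R) : Prop :=
  forall e : R, 0 < e -> exists d0 : R, 0 < d0 /\
    forall delta : R, 0 < delta -> delta < d0 ->
    forall s2 : pert_strat, pert_valid delta s2 -> cost_le A fgoal delta s1 s2 s0 (K + e).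

Definition fgoal0 : nat -> valuation -> R := fun _ _ => 0.

Definition instance := (rpta * nat * rat)%type.

(* the restricted class: well-formed RPTA with 5 clocks, prices in {0,1},
   l an initial location (targets' cost functions are fixed to 0).
   Every cycle has non-negative cost, since all prices are >= 0 and every
   step's duration t + eps >= delta - delta = 0. *)
Definition in_class (x : instance) : Prop :=
  let: (A, l, K) := x in
  [/\ wf_rpta A, nclk A = 5%N, all (fun p : int => (p == 0) || (p == 1)) (prices A)
    & l \in inits A].

Definition upper_bound_yes (x : instance) : Prop :=
  let: (A, l, K) := x in
  exists s1 : ctrl_strat, limcost_le A fgoal0 s1 (inl l, zero_val) (ratr K).

Definition enc (x : instance) : nat := pickle x.

(* Main.v *)
(* Counter c of a two-counter machine is stored as the clock value 3 / 2 ^ c. At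
   each machine step the controller guesses the clock value b of the updated
   counter. The perturbator then either leaves the next delay untouched and the
   play goes on, or shifts it up or down, which guards detect exactly and which
   starts one of two checks of cost 76 + d and 76 - d up to O(delta), where d is
   2 b - a, b - a or b - 2 a depending on the instruction, and vanishes iff the
   guess is right. An honest controller of a halting machine therefore has
   limit-cost at most 76. If the machine does not halt, any controller reaching a
   target against the zero perturbation cheats at some phase, by an amount
   independent of delta, and is caught there.

   No universal machine is needed. A code c deciding the problem is compiled into
   a machine that computes the answer of c on its own automaton and does the
   opposite: it halts iff that answer is 0. The automaton is computable from three
   numbers, the length of the program and the encodings of its edges and prices,
   which the machine receives as input through start-up phases that increment its
   first counter. Only terminating runs of the machine have to be analysed, since
   the alternative to halting is an explicit endless loop. *)

Require Import Defs.
From mathcomp Require Import all_boot all_order all_algebra.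
From mathcomp Require Import zify ring lra Rstruct.
From Stdlib Require Import FunctionalExtensionality Classical.
Set Implicit Arguments. Unset Strict Implicit. Unset Printing Implicit Defensive.

(** The controller commits to a strategy before [delta] is chosen. Against the zero perturbation its
    play is thus the same for all small [delta], so a cheat has a fixed size, while a single shift
    of size [delta] triggers the check: the limit keeps the former and discards the latter. The same
    order of choices constrains the honest controller, whose errors must be O(delta) whatever the
    length of the run. So no counter value is ever copied between clocks. The three counter clocks
    exchange roles instead, which is why the machine swaps its counters at every instruction: a
    value is announced in one phase, passive in the next, active in the one after and then dropped,
    so it meets boundedly many perturbations. Counter values lie in (0, 3] and the offsets make
    every ideal delay at least 1, so the minimum delay [delta] does not get in the way. The
    self-reference is not circular: the program is complete before the number of start-up phases is
    fixed. These are appended behind it, leave its addresses unchanged, and follow one pattern that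
    a code can list. *)

(** * Register programs: increments and loops *)

Inductive stm :=
| Skip
| SInc of nat
| Seq of stm & stm
| Loop of nat & stm.

Notation store := (nat -> nat).
Definition upd (rho : store) i x : store := fun j => if j == i then x else rho j.

Inductive exec : stm -> store -> store -> Prop :=
| ex_skip rho : exec Skip rho rho
| ex_inc i rho : exec (SInc i) rho (upd rho i (rho i).+1)
| ex_seq s1 s2 rho1 rho2 rho3 :
    exec s1 rho1 rho2 -> exec s2 rho2 rho3 -> exec (Seq s1 s2) rho1 rho3
| ex_stop i s rho : rho i = 0 -> exec (Loop i s) rho rho
| ex_loop i s rho1 rho2 rho3 : 0 < rho1 i ->
    exec s (upd rho1 i (rho1 i).-1) rho2 -> exec (Loop i s) rho2 rho3 ->
    exec (Loop i s) rho1 rho3.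

Lemma upd_same rho i x : upd rho i x i = x.
Proof. by rewrite /upd eqxx. Qed.

Lemma upd_upd rho i x y : upd (upd rho i x) i y = upd rho i y.
Proof. by apply: functional_extensionality => j; rewrite /upd; case: eqP. Qed.

Lemma upd_id rho i x : rho i = x -> upd rho i x = rho.
Proof.
by move=> <-; apply: functional_extensionality => j; rewrite /upd; case: eqP => [->|].
Qed.

Lemma exec_eq s rho rho' rho'' : exec s rho rho' -> rho' =1 rho'' -> exec s rho rho''.
Proof. by move=> H /functional_extensionality <-. Qed.

Definition Clear i := Loop i Skip.
Definition Move i j := Loop i (SInc j).
Definition Copy i j t := Seq (Loop i (Seq (SInc j) (SInc t))) (Move t i).

Lemma exec_clear i rho : exec (Clear i) rho (upd rho i 0).
Proof.
move En: (rho i) => n; elim: n rho En => [|n IH] rho En.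
  by rewrite upd_id //; apply: ex_stop.
apply: (ex_loop (rho2 := upd rho i n)); rewrite ?En //; first exact: ex_skip.
by rewrite -(upd_upd rho i n 0); apply: IH; rewrite upd_same.
Qed.

Lemma exec_move i j rho : i != j ->
  exec (Move i j) rho (upd (upd rho j (rho j + rho i)) i 0).
Proof.
move=> ij; move En: (rho i) => n; elim: n rho En => [|n IH] rho En.
  rewrite addn0 (upd_id (x := rho j)) // upd_id //; exact: ex_stop.
apply: ex_loop; first by rewrite En.
  exact: ex_inc.
set rho' := upd _ j _.
have En' : rho' i = n by rewrite /rho' /upd (negbTE ij) eqxx En.
apply: exec_eq (IH rho' En') _ => k.
rewrite /rho' /upd; case: (k == i); case: (k =P j) => //.
by rewrite !eqxx eq_sym (negbTE ij); lia.
Qed.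

Lemma exec_copy i j t rho : i != j -> i != t -> j != t -> rho t = 0 ->
  exec (Copy i j t) rho (upd rho j (rho j + rho i)).
Proof.
move=> ij it jt Ht.
have H n r : r i = n -> exec (Loop i (Seq (SInc j) (SInc t))) r
    (upd (upd (upd r j (r j + n)) t (r t + n)) i 0).
  elim: n r => [|n IH] r En.
    rewrite !addn0 (upd_id (x := r j)) // (upd_id (x := r t)) // upd_id //.
    exact: ex_stop.
  apply: ex_loop; first by rewrite En.
    by apply: ex_seq; apply: ex_inc.
  set r' := upd _ t _.
  have En' : r' i = n by rewrite /r' /upd (negbTE ij) (negbTE it) eqxx En.
  apply: exec_eq (IH r' En') _ => k.
  rewrite /r' /upd; case: (k == i) => //; rewrite (eq_sym t i) (negbTE it) (eq_sym j i) (negbTE ij).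
  rewrite eqxx (eq_sym t j) (negbTE jt) eqxx.
  by case: (k =P t) => // _; [lia | case: (k =P j) => //; lia].
apply: ex_seq; first exact: (H _ _ (erefl _)).
apply: exec_eq; first by apply: exec_move; rewrite eq_sym.
move=> k; rewrite /upd eqxx (eq_sym t i) (negbTE it) eqxx Ht.
case: (k =P t) => [->|kt]; first by rewrite eq_sym (negbTE jt).
by case: (k =P i) => [->|//]; rewrite (negbTE ij); lia.
Qed.

(** * Compiling recursive functions into register programs *)

(** The premises of [ev_mu] sit under an existential quantifier; the hand-written mutual fixpoint
    carries the induction hypothesis through it. *)
Lemma eval_mind (P : code -> seq nat -> nat -> Prop)
    (Q : list code -> seq nat -> seq nat -> Prop) :
  (forall v, P CZero v 0) ->
  (forall x v, P CSucc (x :: v) x.+1) ->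
  (forall i v, i < size v -> P (CProj i) v (nth 0 v i)) ->
  (forall f gs v ws y, Q gs v ws -> P f ws y -> P (CComp f gs) v y) ->
  (forall f g v y, P f v y -> P (CPrimRec f g) (0 :: v) y) ->
  (forall f g n v y z, P (CPrimRec f g) (n :: v) y -> P g (n :: y :: v) z ->
     P (CPrimRec f g) (n.+1 :: v) z) ->
  (forall f v n, P f (n :: v) 0 ->
     (forall m, m < n -> exists k, P f (m :: v) k.+1) -> P (CMu f) v n) ->
  (forall v, Q [::] v [::]) ->
  (forall g gs v w ws, P g v w -> Q gs v ws -> Q (g :: gs) v (w :: ws)) ->
  forall c v y, eval c v y -> P c v y.
Proof.
move=> H1 H2 H3 H4 H5 H6 H7 Q1 Q2.
fix IH 4 with (IHs gs v ws (H : evals gs v ws) {struct H} : Q gs v ws).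
- move=> c v y [] {c v y}.
  + exact: H1.
  + exact: H2.
  + exact: H3.
  + by move=> f gs v ws y Hgs Hf; apply: H4 (IHs _ _ _ Hgs) (IH _ _ _ Hf).
  + by move=> f g v y Hf; apply: H5 (IH _ _ _ Hf).
  + by move=> f g n v y z Hr Hg; apply: H6 (IH _ _ _ Hr) (IH _ _ _ Hg).
  + move=> f v n H0 Hlt; apply: H7 (IH _ _ _ H0) _ => m /Hlt [k Hk].
    by exists k; apply: IH.
- move=> gs v ws [] {gs v ws}.
  + exact: Q1.
  + by move=> g gs v w ws Hg Hgs; apply: Q2 (IH _ _ _ Hg) (IHs _ _ _ Hgs).
Qed.

Fixpoint clears (s m : nat) : stm :=
  if m is m'.+1 then Seq (Clear s) (clears s.+1 m') else Skip.

(** [rs] are the argument registers, [o] the output, [s] the first scratch register. [CPrimRec]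
    keeps the current value in [s], the index in [s.+1] and the remaining rounds in [s.+2]. [CMu]
    keeps the candidate in [s], the value of [f] in [s.+1] and a flag for another round in [s.+2];
    its inner loop clears its own counter and so acts as a conditional. *)
Fixpoint compile (c : code) (rs : seq nat) (o s : nat) : stm :=
  match c with
  | CZero => Skip
  | CSucc => Seq (Copy (head 0 rs) o s) (SInc o)
  | CProj i => Copy (nth 0 rs i) o s
  | CComp f gs =>
    let m := size gs in
    let fix compiles (gs : list code) (j : nat) : stm :=
      if gs is g :: gs' then Seq (compile g rs j (s + m)) (compiles gs' j.+1) else Skip in
    Seq (compiles gs s) (Seq (compile f (iota s m) o (s + m)) (clears s m))
  | CPrimRec f g =>
    let vs := behead rs in
    Seq (compile f vs s s.+4)
    (Seq (Copy (head 0 rs) s.+2 s.+4)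
    (Seq (Loop s.+2 (Seq (compile g (s.+1 :: s :: vs) s.+3 s.+4)
                    (Seq (Clear s) (Seq (Move s.+3 s) (SInc s.+1)))))
    (Seq (Clear s.+1) (Move s o))))
  | CMu f =>
    Seq (SInc s.+2)
    (Seq (Loop s.+2 (Seq (compile f (s :: rs) s.+1 s.+3)
                         (Loop s.+1 (Seq (Clear s.+1) (Seq (SInc s.+2) (SInc s))))))
         (Move s o))
  end.

Definition compiles rs t := fix compiles (gs : list code) (j : nat) : stm :=
  if gs is g :: gs' then Seq (compile g rs j t) (compiles gs' j.+1) else Skip.

(* Registers from [s] on are scratch: zero before and after. *)
Definition comp_ok c v y := forall rs o s rho, map rho rs = v ->
  all (fun i => i < s) rs -> o < s -> o \notin rs -> rho o = 0 ->
  (forall i, s <= i -> rho i = 0) -> exec (compile c rs o s) rho (upd rho o y).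

Definition upds (rho : store) s ws : store :=
  fun i => if (s <= i) && (i < s + size ws) then nth 0 ws (i - s) else rho i.

Definition comps_ok gs v ws := forall rs s t rho, map rho rs = v ->
  all (fun i => i < s) rs -> s + size gs <= t ->
  (forall i, s <= i -> rho i = 0) -> exec (compiles rs t gs s) rho (upds rho s ws).

Ltac by_ifs := repeat (case: ifP => ? //); try lia.

Lemma upds_cons rho s w ws : upds (upd rho s w) s.+1 ws =1 upds rho s (w :: ws).
Proof.
move=> i; rewrite /upds /upd /=; case: (ltngtP s i) => // H.
- by rewrite addSnnS subnS; case: (i - s) (subn_gt0 s i) => //=; rewrite H.
- by rewrite H subnn /= addnS ltnS leq_addr.
Qed.

Lemma exec_clears s m rho : exec (clears s m) rho
  (fun i => if (s <= i) && (i < s + m) then 0 else rho i).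
Proof.
elim: m s rho => [|m IH] s rho /=.
  by apply: exec_eq (ex_skip _) _ => i; by_ifs.
apply: ex_seq; first exact: exec_clear.
by apply: exec_eq (IH _ _) _ => i; rewrite /upd; by_ifs.
Qed.

Lemma map_upd rho i x rs : i \notin rs -> map (upd rho i x) rs = map rho rs.
Proof.
move=> H; apply/eq_in_map => j Hj; rewrite /upd.
by case: eqP Hj H => // -> ->.
Qed.

Lemma notin_lt rs s i : all (fun i => i < s) rs -> s <= i -> i \notin rs.
Proof. by move=> /allP H si; apply/negP => /H; rewrite ltnNge si. Qed.

Lemma all_lt_le rs s t : all (fun i => i < s) rs -> s <= t -> all (fun i => i < t) rs.
Proof. by move=> /allP H st; apply/allP => i /H /leq_trans; apply. Qed.

Ltac upd_tac := let k := fresh "k" in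
  move=> k; rewrite /upd; repeat (case: eqP => ? //=); subst; try lia.

Lemma comp_primrec_ok f g vs n ys : comp_ok f vs (ys 0) ->
  (forall i, i < n -> comp_ok g (i :: ys i :: vs) (ys i.+1)) ->
  comp_ok (CPrimRec f g) (n :: vs) (ys n).
Proof.
move=> Hf Hg [|r rs] o s rho //= [E0 E] /andP [r_s Hrs] os.
rewrite inE negb_or => /andP [ro ors] Ho Hs.
have hs := Hs s (leqnn _); have hs1 := Hs s.+1 (leqnSn _).
have hs2 : rho s.+2 = 0 by apply: Hs; lia.
have hs3 : rho s.+3 = 0 by apply: Hs; lia.
have n0 k : s <= k -> k \notin rs by move=> ?; apply: notin_lt Hrs _.
pose inv i x := upd (upd (upd rho s (ys i)) s.+1 i) s.+2 x.
apply: ex_seq.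
  by apply: (Hf rs s s.+4 rho E) => //;
    [apply: all_lt_le Hrs _; lia | lia | apply: n0
    | move=> i Hi; apply: Hs; lia].
apply: (ex_seq (rho2 := inv 0 n)).
  apply: exec_eq; first apply: exec_copy; try lia.
    by rewrite /upd; case: ifP => [|_]; [lia | apply: Hs; lia].
  by rewrite /inv; upd_tac.
apply: (ex_seq (rho2 := inv n 0)).
  have H m i : i + m = n -> exec (Loop s.+2 (Seq (compile g (s.+1 :: s :: rs) s.+3 s.+4)
      (Seq (Clear s) (Seq (Move s.+3 s) (SInc s.+1))))) (inv i m) (inv n 0).
    elim: m i => [|m IH] i Hi.
      by rewrite -Hi addn0; apply: ex_stop; rewrite /inv upd_same.
    apply: ex_loop; [by rewrite /inv upd_same | | apply: (IH i.+1); lia].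
    rewrite [inv i m.+1 _]/inv upd_same /= {1}/inv upd_upd -/(inv i m).
    apply: ex_seq.
      apply: (Hg i _ (s.+1 :: s :: rs) s.+3 s.+4 (inv i m)); first by lia.
      + rewrite /= /inv !map_upd ?n0 ?E //; try lia.
        by congr [:: _, _ & _]; rewrite /upd; by_ifs.
      + by rewrite /= (all_lt_le Hrs) ?andbT; lia.
      + lia.
      + by rewrite !inE !negb_or n0; lia.
      + by rewrite /inv /upd; by_ifs.
      + by move=> k Hk; rewrite /inv /upd Hs; by_ifs.
    apply: ex_seq; first exact: exec_clear.
    apply: ex_seq; first by apply: exec_move; lia.
    apply: exec_eq; first exact: ex_inc.
    by rewrite /inv; upd_tac.
  exact: H.
apply: ex_seq; first exact: exec_clear.
apply: exec_eq; first by apply: exec_move; lia.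
by rewrite /inv; upd_tac; rewrite ?Ho; lia.
Qed.

Lemma comp_mu_ok f v n : comp_ok f (n :: v) 0 ->
  (forall m, m < n -> exists k, comp_ok f (m :: v) k.+1) -> comp_ok (CMu f) v n.
Proof.
move=> H0 Hlt rs o s rho E Hrs os ors Ho Hs /=.
have hs := Hs s (leqnn _); have hs1 := Hs s.+1 (leqnSn _).
have hs2 : rho s.+2 = 0 by apply: Hs; lia.
have n0 k : s <= k -> k \notin rs by move=> ?; apply: notin_lt Hrs _.
pose inv i x := upd (upd rho s i) s.+2 x.
have Hc i x : comp_ok f (i :: v) x ->
    exec (compile f (s :: rs) s.+1 s.+3) (inv i 0) (upd (inv i 0) s.+1 x).
  apply.
  + rewrite /= /inv !map_upd ?n0 ?E //; try lia.
    by congr (_ :: _); rewrite /upd; by_ifs.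
  + by rewrite /= (all_lt_le Hrs) ?andbT; lia.
  + lia.
  + by rewrite !inE !negb_or n0; lia.
  + by rewrite /inv /upd; by_ifs.
  + by move=> k Hk; rewrite /inv /upd Hs; by_ifs.
apply: (ex_seq (rho2 := inv 0 1)).
  by apply: exec_eq; [exact: ex_inc | rewrite /inv; upd_tac].
apply: (ex_seq (rho2 := inv n 0)).
  have H m i : i + m = n -> exec (Loop s.+2 (Seq (compile f (s :: rs) s.+1 s.+3)
      (Loop s.+1 (Seq (Clear s.+1) (Seq (SInc s.+2) (SInc s)))))) (inv i 1) (inv n 0).
    elim: m i => [|m IH] i Hi.
      apply: (ex_loop (rho2 := inv n 0)); [by rewrite /inv upd_same | | ].
        rewrite [inv i 1 _]/inv upd_same /= {1}/inv upd_upd -/(inv i 0).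
        have -> : i = n by lia.
        apply: ex_seq; first exact: Hc H0.
        rewrite upd_id; last by rewrite /inv /upd; by_ifs.
        by apply: ex_stop; rewrite /inv /upd; by_ifs.
      by apply: ex_stop; rewrite /inv upd_same.
    have /Hlt [k Hk] : i < n by lia.
    apply: (ex_loop (rho2 := inv i.+1 1)); [by rewrite /inv upd_same | | apply: IH; lia].
    rewrite [inv i 1 _]/inv upd_same /= {1}/inv upd_upd -/(inv i 0).
    apply: ex_seq; first exact: Hc Hk.
    apply: (ex_loop (rho2 := inv i.+1 1)); first by rewrite upd_same.
      apply: ex_seq; first exact: exec_clear.
      apply: ex_seq; first exact: ex_inc.
      apply: exec_eq; first exact: ex_inc.
      by rewrite /inv; upd_tac.
    by apply: ex_stop; rewrite /inv /upd; by_ifs.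
  exact: H.
apply: exec_eq; first by apply: exec_move; lia.
by rewrite /inv; upd_tac; rewrite ?Ho; lia.
Qed.

(* [CPrimRec] recurses downwards while the compiled loop counts upwards, so the
   induction on [eval] carries the whole sequence of intermediate values. *)
Definition primrec_trace c v y := forall f g n vs, c = CPrimRec f g -> v = n :: vs ->
  exists ys, [/\ comp_ok f vs (ys 0),
    forall i, i < n -> comp_ok g (i :: ys i :: vs) (ys i.+1) & y = ys n].

Lemma comp_correct c v y : eval c v y -> comp_ok c v y.
Proof.
pose P c v y := comp_ok c v y /\ primrec_trace c v y.
suff H : forall c v y, eval c v y -> P c v y by move=> /H [].
apply: (eval_mind (Q := fun gs v ws => comps_ok gs v ws /\ size ws = size gs)).
- move=> {}v; split=> // rs o s rho _ _ _ _ Ho _ /=; rewrite upd_id //; exact: ex_skip.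
- move=> x {}v; split=> // - [|r rs] o s rho //= [<- _] /andP [rs_s _] os.
  rewrite inE negb_or => /andP [ro _] Ho Hs.
  apply: ex_seq.
    by apply: exec_copy; [rewrite eq_sym | lia | lia | apply: Hs].
  by apply: exec_eq (ex_inc _ _) _ => k; rewrite /upd eqxx Ho; case: eqP.
- move=> i {}v iv; split=> // rs o s rho E /allP Hrs os ors Ho Hs /=.
  have iv' : i < size rs by rewrite -E size_map in iv.
  have Hi : nth 0 rs i \in rs by apply: mem_nth.
  have -> : nth 0 v i = rho o + rho (nth 0 rs i) by rewrite Ho -E (nth_map 0).
  apply: exec_copy; last exact: Hs.
  + by apply: contraNneq ors => <-.
  + by have := Hrs _ Hi; lia.
  + by lia.
- move=> f gs {}v ws {}y [Hgs sz] [Hf _]; split=> // rs o s rho E Hrs os ors Ho Hs /=.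
  set m := size gs.
  rewrite -/(compiles rs (s + m)).
  apply: ex_seq; first exact: (Hgs _ _ _ _ E Hrs (leqnn _) Hs).
  apply: ex_seq.
    apply: Hf.
    + apply: (@eq_from_nth _ 0) => [|i]; first by rewrite size_map size_iota sz.
      rewrite size_map size_iota => im; rewrite (nth_map 0) ?size_iota // nth_iota //.
      by rewrite /upds leq_addr ltn_add2l sz im addKn.
    + by apply/allP => i; rewrite mem_iota => /andP [].
    + by rewrite ltn_addr.
    + by rewrite mem_iota negb_and -ltnNge os.
    + by rewrite /upds leqNgt os.
    + move=> i Hi; rewrite /upds sz -/m ltnNge Hi andbF Hs //; lia.
  apply: exec_eq (exec_clears _ _ _) _ => i; rewrite /upds /upd sz -/m.
  case: (boolP (s <= i < s + m)) => // /andP [si _].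
  by rewrite Hs // ifF //; apply/eqP => ioeq; move: si; rewrite ioeq leqNgt os.
- move=> f g {}v {}y [Hf _].
  split; last by move=> f' g' n vs [<- _] [<- <-]; exists (fun=> y).
  exact: (comp_primrec_ok (ys := fun=> y)).
- move=> f g n {}v {}y z [_ Hr] [Hg _].
  have {Hr} [ys [H0 Hi Ey]] := Hr _ _ _ _ (erefl _) (erefl _).
  (* [ys] is constrained only up to [n], so its value at [n.+1] can be overwritten. *)
  pose zs i := if i == n.+1 then z else ys i.
  have Z0 : comp_ok f v (zs 0) by [].
  have Zi i : i < n.+1 -> comp_ok g (i :: zs i :: v) (zs i.+1).
    rewrite ltnS leq_eqVlt => /orP [/eqP ->|ilt].
      by rewrite /zs eqxx -Ey ltn_eqF.
    by rewrite /zs eqSS !ltn_eqF //; [apply: Hi | lia].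
  have Ez : z = zs n.+1 by rewrite /zs eqxx.
  split; first by rewrite Ez; apply: comp_primrec_ok.
  by move=> f' g' n' vs [<- <-] [<- <-]; exists zs.
- move=> f {}v n [H0 _] Hlt; split=> //; apply: comp_mu_ok => // m /Hlt [k [Hk _]].
  by exists k.
- move=> {}v; split=> // rs s t rho _ _ _ _ /=.
  by apply: exec_eq (ex_skip _) _ => i; rewrite /upds /=; by_ifs.
- move=> g gs {}v w ws [Hg _] [Hgs sz]; split; last by rewrite /= sz.
  move=> rs s t rho E Hrs /= st Hs.
  apply: ex_seq.
    apply: (Hg rs s t rho E) => //;
      [apply: all_lt_le Hrs _; lia | lia | exact: notin_lt Hrs _
      | apply: Hs => // | move=> i Hi; apply: Hs; lia].
  apply: exec_eq; last exact: upds_cons.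
  apply: Hgs.
  + rewrite map_upd //; exact: notin_lt Hrs _.
  + by apply: all_lt_le Hrs _.
  + by lia.
  + by move=> i Hi; rewrite /upd; case: eqP => [?|_]; [lia | apply: Hs; lia].
Qed.

(** * Two-counter machines *)

Inductive op := OInc | ODec | OKeep.
Definition app_op o c := match o with OInc => c.+1 | ODec => c.-1 | OKeep => c end.
Definition op_ok o c := if o is ODec then 0 < c else true.

(* An instruction acts on the first counter, swaps the two counters and then
   branches on the new first one: (operation, target if zero, target otherwise).
   Program counter 0 means halted; the instruction at pc is [nth _ P pc.-1]. *)
Definition instr := (op * nat * nat)%type.
Definition cfg := (nat * nat * nat)%type.
Definition fetch (P : seq instr) pc : instr := nth (OKeep, 0, 0) P pc.-1.
Definition mstep P (s : cfg) : cfg :=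
  let: (pc, c1, c2) := s in let: (o, lz, lp) := fetch P pc in
  (if c2 == 0 then lz else lp, c2, app_op o c1).
Definition valid P (s : cfg) : bool :=
  let: (pc, c1, c2) := s in (0 < pc <= size P) && op_ok (fetch P pc).1.1 c1.

Definition reach P s s' :=
  exists2 n, iter n (mstep P) s = s' & forall k, k < n -> valid P (iter k (mstep P) s).

Lemma reach_refl P s : reach P s s.
Proof. by exists 0. Qed.

Lemma reach_trans P s1 s2 s3 : reach P s1 s2 -> reach P s2 s3 -> reach P s1 s3.
Proof.
move=> [m <- Hm] [n <- Hn]; exists (n + m); first by rewrite iterD.
move=> k Hk; have [/Hm //|mk] := ltnP k m.
by rewrite -(subnK mk) iterD; apply: Hn; lia.
Qed.

Lemma reach_step P s s' : valid P s -> reach P (mstep P s) s' -> reach P s s'.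
Proof. by move=> V; apply: reach_trans; exists 1 => // -[]. Qed.

Definition code_at P b (ls : seq instr) :=
  exists p q, P = p ++ ls ++ q /\ b = (size p).+1.

Lemma code_at_cat P b l1 l2 :
  code_at P b (l1 ++ l2) -> code_at P b l1 /\ code_at P (b + size l1) l2.
Proof.
move=> [p [q [-> ->]]]; split.
  by exists p, (l2 ++ q); rewrite -catA.
by exists (p ++ l1), q; rewrite -!catA size_cat.
Qed.

Lemma code_at_fetch P b ls i : code_at P b ls -> i < size ls ->
  (0 < b + i <= size P) /\ fetch P (b + i) = nth (OKeep, 0, 0) ls i.
Proof.
move=> [p [q [-> ->]]] Hi; rewrite !size_cat; split; first lia.
by rewrite /fetch addSn /= nth_cat ltnNge leq_addr /= addKn nth_cat Hi.
Qed.

Lemma code_at_step P b ls i o lz lp c1 c2 s' : code_at P b ls ->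
  i < size ls -> nth (OKeep, 0, 0) ls i = (o, lz, lp) -> op_ok o c1 ->
  reach P (if c2 == 0 then lz else lp, c2, app_op o c1) s' ->
  reach P (b + i, c1, c2) s'.
Proof.
move=> Hc Hi Hn Ho Hr; have [Hb Hf] := code_at_fetch Hc Hi.
by apply: reach_step; rewrite /= Hf Hn //= Hb.
Qed.

(** * Multiplication, division and divisibility tests with two counters *)

(** Operations come in pairs because two instructions bring the counters back in order. Only the
    last pair branches on the first counter; the closing [OKeep] swaps, so that the total gathered
    in the second counter ends up in the first. *)
Fixpoint loop_code (body : seq (op * op)) cur top : seq instr :=
  if body is (o1, o2) :: bd then
    (o1, cur.+1, cur.+1) :: (o2, cur.+2, if bd is [::] then top else cur.+2)
      :: loop_code bd cur.+2 top
  else [:: (OKeep, cur.+1, cur.+1)].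

Lemma size_loop_code body cur top : size (loop_code body cur top) = (size body).*2.+1.
Proof. by elim: body cur => [|[o1 o2] bd IH] cur //=; rewrite IH. Qed.

Lemma nth_loop_code body cur top :
  nth (OKeep, 0, 0) (loop_code body cur top) (size body).*2 =
  (OKeep, cur + (size body).*2.+1, cur + (size body).*2.+1).
Proof.
elim: body cur => [|[o1 o2] bd IH] cur /=; first by rewrite addn1.
by rewrite IH !addSnnS.
Qed.

Fixpoint body_run (body : seq (op * op)) x y : option (nat * nat) :=
  if body is (o1, o2) :: bd then
    if op_ok o1 x && op_ok o2 y then body_run bd (app_op o1 x) (app_op o2 y) else None
  else Some (x, y).

Lemma loop_body P cur top body x y x' y' : 0 < size body ->
  code_at P cur (loop_code body cur top) -> body_run body x y = Some (x', y') ->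
  reach P (cur, x, y) (if x' == 0 then cur + (size body).*2 else top, x', y').
Proof.
elim: body cur x y => [//|[o1 o2] bd IH] cur x y _ Hc /=.
case: ifP => // /andP [ok1 ok2] Hr.
rewrite -[X in reach _ (X, _, _)](addn0 cur).
apply: (code_at_step Hc (i := 0) (o := o1) (lz := cur.+1) (lp := cur.+1)) => //.
rewrite if_same -(addn1 cur).
apply: (code_at_step Hc (i := 1)) => //=.
case: bd IH Hc Hr => [|p bd] IH Hc Hr.
  case: Hr => <- <-; rewrite /= addn2; exact: reach_refl.
rewrite if_same.
have := IH cur.+2 _ _ isT _ Hr; rewrite !addSnnS /=; apply.
case: Hc => p' [q [-> ->]].
exists (rcons (rcons p' (o1, (size p').+2, (size p').+2)) (o2, (size p').+3, (size p').+3)), q.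
by rewrite !size_rcons -!cats1 -!catA.
Qed.

Definition mul_body p := (ODec, OInc) :: nseq p.-1 (OKeep, OInc).
Definition div_body p := rcons (nseq p.-1 (ODec, OKeep)) (ODec, OInc).

Lemma mul_body_run p x y : 0 < p -> body_run (mul_body p) x.+1 y = Some (x, y + p).
Proof.
case: p => // p _ /=; rewrite addnS -addSn; elim: p y.+1 => [|p IH] {}y /=.
  by rewrite addn0.
by rewrite IH addSnnS.
Qed.

Lemma div_body_run p x y : 0 < p -> body_run (div_body p) (x + p) y = Some (x, y.+1).
Proof.
case: p => // p _; rewrite /div_body /=; elim: p => [|p IH] /=; first by rewrite addn1.
by rewrite addnS /= IH.
Qed.

Lemma mul_loop P b p x y : 0 < p -> code_at P b (loop_code (mul_body p) b b) ->
  reach P (b, x.+1, y) (b + p.*2.+1, y + x.+1 * p, 0).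
Proof.
move=> p0 Hc.
have sz : size (mul_body p) = p by rewrite /= size_nseq; lia.
have nth_top := nth_loop_code (mul_body p) b b; rewrite sz in nth_top.
elim: x y => [|x IH] y;
  apply: reach_trans (loop_body _ Hc (mul_body_run _ _ p0)) _ => //; rewrite ?sz /=.
  apply: (code_at_step Hc (i := p.*2) (o := OKeep) (lz := b + p.*2.+1) (lp := b + p.*2.+1)) => //.
  - by rewrite size_loop_code sz.
  - rewrite if_same /= mul1n; exact: reach_refl.
by rewrite (mulSn x.+1) addnA; apply: IH.
Qed.

Lemma div_loop P b p x y : 0 < p -> code_at P b (loop_code (div_body p) b b) ->
  reach P (b, x.+1 * p, y) (b + p.*2.+1, y + x.+1, 0).
Proof.
move=> p0 Hc.
have sz : size (div_body p) = p by rewrite size_rcons size_nseq; lia.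
have nth_top := nth_loop_code (div_body p) b b; rewrite sz in nth_top.
have nz : 0 < size (div_body p) by rewrite sz.
elim: x y => [|x IH] y; rewrite mulSn addnC;
  apply: reach_trans (loop_body nz Hc (div_body_run _ _ p0)) _.
  rewrite /= sz.
  apply: (code_at_step Hc (i := p.*2) (o := OKeep) (lz := b + p.*2.+1) (lp := b + p.*2.+1)) => //.
  - by rewrite size_loop_code sz.
  - rewrite /= addn1; exact: reach_refl.
have -> : (x.+1 * p == 0) = false by rewrite muln_eq0; lia.
by have := IH y.+1; rewrite addSnnS.
Qed.

(** The position in the block is the residue modulo [p] of what has been moved to the second
    counter; when the first is exhausted, only the last pair reports divisibility. Both exits swap
    the value back into the first counter. *)
Definition test_code p b lno : seq instr :=
  mkseq (fun i => if odd i then (OInc, if i.+1 == p.*2 then b + p.*2.+1 else b + p.*2,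
                                 if i.+1 == p.*2 then b else b + i.+1)
                  else (ODec, b + i.+1, b + i.+1)) p.*2
  ++ [:: (OKeep, lno, lno); (OKeep, b + p.*2.+2, b + p.*2.+2)].

Lemma size_test_code p b lno : size (test_code p b lno) = p.*2.+2.
Proof. by rewrite size_cat size_mkseq addn2. Qed.

Lemma test_loop P b p lno x y j : j < p -> code_at P b (test_code p b lno) ->
  reach P (b + j.*2, x.+1, y)
    (if p %| j + x.+1 then b + p.*2.+2 else lno, y + x.+1, 0).
Proof.
move=> jp Hc; elim: x y j jp => [|x IH] y j jp.
  have Hj : j.*2.+1 < p.*2 by lia.
  have Hn i : i < p.*2 -> nth (OKeep, 0, 0) (test_code p b lno) i =
     if odd i then (OInc, if i.+1 == p.*2 then b + p.*2.+1 else b + p.*2,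
                                 if i.+1 == p.*2 then b else b + i.+1)
                  else (ODec, b + i.+1, b + i.+1).
    by move=> Hi; rewrite nth_cat size_mkseq Hi nth_mkseq.
  apply: (code_at_step Hc); rewrite ?size_test_code ?Hn ?odd_double //; try lia.
  rewrite if_same /=.
  apply: (code_at_step Hc); rewrite ?size_test_code ?Hn //=; rewrite ?odd_double //=; try lia.
  rewrite addn1 -doubleS; have -> : (j.+1.*2 == p.*2) = (p %| j.+1).
    apply/eqP/idP => [/double_inj -> //|/dvdn_leq]; lia.
  case: (p %| j.+1).
    apply: (code_at_step Hc (i := p.*2.+1) (lz := b + p.*2.+2) (lp := b + p.*2.+2) (o := OKeep)); rewrite ?size_test_code //.
      by rewrite nth_cat size_mkseq ltnNge leqnSn /= subSnn.
    by rewrite /= addn1; exact: reach_refl.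
  apply: (code_at_step Hc (i := p.*2) (lz := lno) (lp := lno) (o := OKeep)); rewrite ?size_test_code //.
    by rewrite nth_cat size_mkseq ltnn subnn.
  by rewrite /= addn1; exact: reach_refl.
have Hj : j.*2.+1 < p.*2 by lia.
have Hn i : i < p.*2 -> nth (OKeep, 0, 0) (test_code p b lno) i =
   if odd i then (OInc, if i.+1 == p.*2 then b + p.*2.+1 else b + p.*2,
                               if i.+1 == p.*2 then b else b + i.+1)
                else (ODec, b + i.+1, b + i.+1).
  by move=> Hi; rewrite nth_cat size_mkseq Hi nth_mkseq.
apply: (code_at_step Hc); rewrite ?size_test_code ?Hn ?odd_double //; try lia.
rewrite if_same /=.
apply: (code_at_step Hc); rewrite ?size_test_code ?Hn //=; rewrite ?odd_double //=; try lia.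
rewrite -doubleS (addnS j) -(addSnnS y) -addSn; case: eqP => [/double_inj E|E].
  rewrite E dvdn_addr //.
  by have := IH y.+1 0; rewrite addn0 add0n; apply; lia.
by apply: IH; lia.
Qed.

(** * Registers as prime exponents of one counter *)

Fixpoint pr (i : nat) : nat := if i is j.+1 then s2val (prime_above (pr j)) else 2.

Lemma pr_prime i : prime (pr i).
Proof. by case: i => //= i; case: prime_above. Qed.

Lemma pr_mono i j : i < j -> pr i < pr j.
Proof.
elim: j => // j IH; rewrite ltnS leq_eqVlt => /orP [/eqP ->|/IH H] /=; case: prime_above => //= q jq _ //.
exact: ltn_trans jq.
Qed.

Lemma pr_inj i j : (pr i == pr j) = (i == j).
Proof.
case: (ltngtP i j) => [/pr_mono H|/pr_mono H|->]; last by rewrite eqxx.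
  by rewrite ltn_eqF.
by rewrite gtn_eqF.
Qed.

(* The first counter holds the product of the [pr i ^ rho i]. *)
Definition rep (rho : store) A := 0 < A /\ forall i, logn (pr i) A = rho i.

Lemma rep_inc rho A i : rep rho A -> rep (upd rho i (rho i).+1) (A * pr i).
Proof.
move=> [A0 H]; have p0 := prime_gt0 (pr_prime i).
split=> [|j]; first by rewrite muln_gt0 A0.
rewrite lognM // H logn_prime ?pr_prime // pr_inj /upd eq_sym; case: eqP => [->|]; lia.
Qed.

Lemma rep_dvd rho A i : rep rho A -> (pr i %| A) = (0 < rho i).
Proof. by move=> [A0 H]; rewrite -(H i) logn_gt0 mem_primes pr_prime A0. Qed.

Lemma rep_div rho A i : rep rho A -> 0 < rho i -> rep (upd rho i (rho i).-1) (A %/ pr i).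
Proof.
move=> Hr Hi; have p0 := prime_gt0 (pr_prime i).
have Hd : pr i %| A by rewrite (rep_dvd i Hr).
case: Hr => A0 H; split=> [|j]; first by rewrite divn_gt0 // dvdn_leq.
rewrite logn_div // H logn_prime ?pr_prime // pr_inj /upd eq_sym; case: eqP => [->|]; lia.
Qed.

(** Divisibility by [pr i] tests register [i], and division is the decrement that [Loop] performs
    before its body. The jump back takes two [OKeep], since one would leave the counters swapped. *)
Fixpoint emit (s : stm) (b : nat) : seq instr :=
  match s with
  | Skip => [::]
  | SInc i => loop_code (mul_body (pr i)) b b
  | Seq s1 s2 => let c1 := emit s1 b in c1 ++ emit s2 (b + size c1)
  | Loop i s =>
    let p := pr i in
    let b1 := b + p.*2.+2 in
    let b2 := b1 + p.*2.+1 in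
    let c := emit s b2 in
    let b3 := b2 + size c in
    test_code p b (b3 + 2) ++ loop_code (div_body p) b1 b1 ++ c
      ++ [:: (OKeep, b3.+1, b3.+1); (OKeep, b, b)]
  end.

Lemma emit_correct s rho rho' : exec s rho rho' -> forall P b A,
  code_at P b (emit s b) -> rep rho A ->
  exists2 A', rep rho' A' & reach P (b, A, 0) (b + size (emit s b), A', 0).
Proof.
elim: s rho rho' / => [rho|i rho|s1 s2 r1 r2 r3 _ IH1 _ IH2|i s rho Hi|i s r1 r2 r3 Hi _ IH1 _ IH2] P b A Hc Hr.
- by exists A => //=; rewrite addn0; exact: reach_refl.
- exists (A * pr i); first exact: rep_inc.
  rewrite size_loop_code /= size_nseq prednK ?prime_gt0 ?pr_prime //.
  have := mul_loop A.-1 0 (prime_gt0 (pr_prime i)) Hc.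
  by rewrite prednK ?add0n //; case: Hr.
- move: Hc => /= /code_at_cat [Hc1 Hc2].
  have [A' Hr' R1] := IH1 _ _ _ Hc1 Hr.
  have [A'' Hr'' R2] := IH2 _ _ _ Hc2 Hr'.
  exists A'' => //; rewrite size_cat addnA; exact: reach_trans R1 R2.
- exists A => //; move: Hc => /= /code_at_cat [Hc1 _].
  have := test_loop A.-1 0 (prime_gt0 (pr_prime i)) Hc1.
  have A0 : 0 < A by case: Hr.
  rewrite (prednK A0) (rep_dvd i Hr) Hi /= addn0 add0n => R.
  rewrite size_cat size_test_code !size_cat size_loop_code size_rcons size_nseq.
  by rewrite prednK ?prime_gt0 ?pr_prime // !addnA.
- have Hc0 := Hc; set e := b + size _; move: Hc => /= /code_at_cat [Hc1 /code_at_cat [Hc2 /code_at_cat [Hc3 Hc4]]].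
  have p0 := prime_gt0 (pr_prime i).
  have A0 : 0 < A by case: Hr.
  have Hd : pr i %| A by rewrite (rep_dvd i Hr).
  have := test_loop A.-1 0 p0 Hc1.
  rewrite prednK // Hd addn0 add0n => R1.
  rewrite size_test_code in Hc2 Hc3 Hc4.
  have := div_loop (A %/ pr i).-1 0 p0 Hc2.
  rewrite prednK ?divn_gt0 // ?(dvdn_leq A0) // divnK // add0n => R2.
  rewrite size_loop_code size_rcons size_nseq prednK // in Hc3 Hc4.
  have [A' Hr' R3] := IH1 _ _ _ Hc3 (rep_div Hr Hi).
  have [A'' Hr'' R4] := IH2 _ _ _ Hc0 Hr'.
  rewrite -/e in R4.
  exists A'' => //.
  apply: reach_trans R1 _; apply: reach_trans R2 _; apply: reach_trans R3 _.
  rewrite -[X in reach _ (X, _, _)]addn0.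
  apply: (code_at_step Hc4) => //=; rewrite ?if_same -?(addn1 (_ + size _)).
  apply: (code_at_step Hc4) => //=; rewrite ?if_same -?(addn1 (_ + size _)).
  exact: R4.
Qed.

Import Order.TTheory GRing.Theory Num.Theory.
Local Open Scope ring_scope.

(** * Plays *)

Section Run.
Variables (A : rpta) (delta : R) (s1 : ctrl_strat) (s2 : pert_strat) (s0 : state).
Local Notation run := (run A delta s1 s2 s0).

Definition extend (h : hist) (m : R * edge) (eps : R) : hist :=
  (h.1, rcons h.2 (Step m.1 m.2 eps
     (e_dst m.2, delay_reset (cur h).2 (m.1 + eps) (e_reset m.2)))).

Lemma cur_extend h m eps :
  cur (extend h m eps) = (e_dst m.2, delay_reset (cur h).2 (m.1 + eps) (e_reset m.2)).
Proof. by rewrite /cur /= map_rcons last_rcons. Qed.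

Lemma size_extend h m eps : size (extend h m eps).2 = (size h.2).+1.
Proof. by rewrite size_rcons. Qed.

Lemma acc_extend h m eps : acc_cost A (extend h m eps) =
  acc_cost A h + (m.1 + eps) * (eta A (e_src m.2))%:~R.
Proof. by rewrite /acc_cost /= -cats1 big_cat big_seq1. Qed.

Lemma run_extend k h l : run k = Some h -> (cur h).1 = inl l ->
  legal A delta l (cur h).2 (s1 h) -> run k.+1 = Some (extend h (s1 h) (s2 h (s1 h))).
Proof. by move=> /= -> -> ->. Qed.

Lemma run_extend_inv k h l : run k = Some h -> (cur h).1 = inl l -> run k.+1 <> None ->
  legal A delta l (cur h).2 (s1 h) /\
  run k.+1 = Some (extend h (s1 h) (s2 h (s1 h))).
Proof. by move=> /= -> ->; case: ifP. Qed.

Lemma run_target k h j n : run k = Some h -> (cur h).1 = inr j -> run (n + k) = Some h.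
Proof. by move=> H Hj; elim: n => //= n ->; rewrite Hj. Qed.

Lemma run_some_le k n : run (n + k) <> None -> run k <> None.
Proof. by elim: n => // n IH H; apply: IH => E; apply: H; rewrite addSn /= E. Qed.

Lemma target_uniq k h j k' h' j' : run k = Some h -> (cur h).1 = inr j ->
  run k' = Some h' -> (cur h').1 = inr j' -> h = h'.
Proof.
wlog kk : k h j k' h' j' / (k <= k')%N => [W|] H Hj H' Hj'.
  have [kk|kk] := leqP k k'; first exact: (W _ _ _ _ _ _ kk H Hj H' Hj').
  exact/esym/(W _ _ _ _ _ _ (ltnW kk) H' Hj' H Hj).
by have := run_target (k' - k) H Hj; rewrite subnK // H' => -[].
Qed.

(** A blocked play stays blocked and a play at a target stays there, so a finite cost rules out
    illegal moves at every step. *)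
Lemma cost_le_never_stuck fgoal b : cost_le A fgoal delta s1 s2 s0 b ->
  forall k, run k <> None.
Proof.
move=> [k [h [j [H [Hj _]]]]] n.
have [kn|nk] := leqP k n.
  by rewrite -(subnK kn) (run_target _ H Hj).
by apply: (@run_some_le n (k - n)); rewrite subnK ?(ltnW nk) // H.
Qed.

End Run.

(** Compares a perturbator who acts late with the idle one: the play reaches the guess under attack
    unchanged. *)
Lemma run_same A delta s1 s2 s2' s0 k :
  (forall h m, (size h.2 < k)%N -> s2 h m = s2' h m) ->
  run A delta s1 s2 s0 k = run A delta s1 s2' s0 k.
Proof.
move=> H; suff : run A delta s1 s2 s0 k = run A delta s1 s2' s0 k /\
  forall h, run A delta s1 s2 s0 k = Some h -> (size h.2 <= k)%N by case.
elim: k H => [|k IH] H; first by split=> // h [<-].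
have [E1 Hs] := IH (fun h m Hh => H h m (leqW Hh)); rewrite /= -E1.
case E: (run A delta s1 s2 s0 k) => [h|//]; have szh := Hs _ E.
case: (cur h).1 => [l|j]; last by split=> // h' [<-]; apply: leqW.
by case: ifP => // _; rewrite (H h) //; split=> // h' [<-]; rewrite size_rcons.
Qed.

(** * The automaton *)

(* Three clocks take turns, the phase being counted by r modulo 3, as the active
   counter, the passive counter and the clock receiving the new value of the
   active counter; clock 3 measures the phase and clock 4 is auxiliary. *)
Definition act (r : nat) : nat := r.
Definition pas (r : nat) : nat := ((r + 1) %% 3)%N.
Definition fre (r : nat) : nat := ((r + 2) %% 3)%N.

(* (clock, value to wait for, clocks to reset) *)
Definition wait := (nat * int * seq nat)%type.

(* Each pair of waits (c, v), (4, v) splits a period of length v into v - x and x,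
   where x is the value of the clock c, and restores x; the waits for 6 stand in
   for a missing second copy, and [pad] makes both checks cost 76. *)
Definition waits (o : op) (r : nat) (pad : nat) : seq wait :=
  let w := fre r in let u := act r in
  [:: (w, 8%:Z, [:: w]); (4, 8%:Z, [:: 4]);
      if o is OInc then (w, 8%:Z, [:: w]) else (4, 6%:Z, [::]); (4, 8%:Z, [:: 4]);
      (u, 36%:Z, [:: u]); (4, 36%:Z, [:: 4]);
      if o is ODec then (u, 36%:Z, [:: u]) else (4, 6%:Z, [::]); (4, 36%:Z, [:: 4]);
      (4, pad%:Z, [::])]%N.

(* Edge templates (tag of the source, guard, reset, destination); destination
   [inl t] is the tag t of the same phase, [inr 0] the target, [inr 1] and
   [inr 2] the next phase when the passive counter is zero, resp. positive. *)
Definition tmpl := (nat * guard * seq nat * (nat + nat))%type.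

Fixpoint chain (t : nat) (ws : seq wait) : seq tmpl :=
  if ws is w :: ws' then
    (t, [:: (w.1.1, CEq, w.1.2)], w.2, if ws' is [::] then inr 0%N else inl t.+1) :: chain t.+1 ws'
  else [::].

(* A phase lasts 6 time units and starts with the clock 3 at 0, the active clock
   at a + 8 and the passive one at a' + 2, where a and a' encode the counters.
   Tag 0 is the guess: resetting [fre r] after a delay 4 - b announces the new
   value b. The perturbation at tag 1 shifts the clock 3 but not the clock 4, which
   is reset there, so that it can be read off at tag 2: if it is nonzero, one of
   the two checks (tags 3 to 11 and 12 to 20) ends the play. *)
Definition phase (o : op) (r : nat) : seq tmpl :=
  [:: (0, [::], [:: fre r], inl 1);
      (1, [:: (3, CEq, 5%:Z)], [:: 4], inl 2);
      (2, [:: (4, CEq, 1%:Z); (3, CEq, 6%:Z); (pas r, CGt, 10%:Z)], [:: 3], inr 1);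
      (2, [:: (4, CEq, 1%:Z); (3, CEq, 6%:Z); (pas r, CLt, 10%:Z)], [:: 3], inr 2);
      (2, [:: (4, CEq, 1%:Z); (3, CGt, 6%:Z)], [:: 4], inl 3);
      (2, [:: (4, CEq, 1%:Z); (3, CLt, 6%:Z)], [:: 4], inl 12)]%N
  ++ chain 3 (waits o r 60) ++ chain 12 (waits o r 4).

(* Indexed by the tag. *)
Definition price_pattern : seq int :=
  [:: 0; 0; 0; 0; 1; 0; 1; 1; 0; 1; 0; 1; 1; 0; 1; 0; 0; 1; 0; 1; 1].

Definition loc (pc r tag : nat) : nat := (63 * pc + 21 * r + tag)%N.
(* Locations 0 and 1 are the initial ones, which the halting program counter 0
   leaves free. *)
Definition goto (pc r : nat) : nat + nat :=
  if pc is 0 then inr 0%N else inl (loc pc r 0).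

Definition dst (pc r lz lp : nat) (d : nat + nat) : nat + nat :=
  match d with
  | inl t => inl (loc pc r t)
  | inr 0 => inr 0%N
  | inr 1 => goto lz ((r + 1) %% 3)
  | inr _ => goto lp ((r + 1) %% 3)
  end.

Definition inst (pc r lz lp : nat) (t : tmpl) : edge :=
  (loc pc r t.1.1.1, t.1.1.2, t.1.2, dst pc r lz lp t.2).

Lemma e_src_inst pc r lz lp t : e_src (inst pc r lz lp t) = loc pc r t.1.1.1.
Proof. by []. Qed.

Definition gadget (pc : nat) (i : instr) : seq edge :=
  flatten [seq [seq inst pc r i.1.2 i.2 t | t <- phase i.1.1 r] | r <- iota 0 3].

Definition init0 : edge := (0%N, [:: (0%N, CEq, 6%:Z)], [:: 1%N], inl 1%N).
Definition init1 (start : nat) : edge :=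
  (1%N, [:: (0%N, CEq, 11%:Z)], [:: 3%N], inl (loc start 0 0)).

(** Edges are described up to membership because the list that gets encoded puts the start-up phases
    in front of the program. Prices include program counter 0, which covers the two initial
    locations. *)
Record implements (A : rpta) (P : seq instr) (start : nat) : Prop := Implements {
  impl_edges : forall e, (e \in edges A) =
    (e \in [:: init0; init1 start]) ||
    has (fun pc => e \in gadget pc (fetch P pc)) (iota 1 (size P));
  impl_eta : forall pc r t, (pc <= size P)%N -> (r < 3)%N -> (t < 21)%N ->
    eta A (loc pc r t) = nth 0 price_pattern t }.

Lemma loc_decode pc r t : (r < 3)%N -> (t < 21)%N ->
  [/\ loc pc r t %/ 63 = pc, (loc pc r t %% 63) %/ 21 = r & loc pc r t %% 21 = t]%N.
Proof.
rewrite /loc => rlt tlt.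
have E : (63 * pc + 21 * r + t = pc * 63 + (21 * r + t))%N by lia.
split.
- by rewrite E divnMDl // divn_small; lia.
- rewrite E modnMDl (modn_small (m := 21 * r + t)); last lia.
  by rewrite mulnC divnMDl // divn_small; lia.
- have -> : (63 * pc + 21 * r + t = (3 * pc + r) * 21 + t)%N by lia.
  by rewrite modnMDl modn_small.
Qed.

Section Edges.
Variables (A : rpta) (P : seq instr) (start : nat).
Hypothesis HA : implements A P start.
Variables (pc r : nat).
Hypotheses (Hpc : (0 < pc <= size P)%N) (Hr : (r < 3)%N).

Lemma phase_edge o lz lp t : fetch P pc = (o, lz, lp) -> t \in phase o r ->
  inst pc r lz lp t \in edges A.
Proof.
move=> Hf Ht; rewrite (impl_edges HA); apply/orP; right.
apply/hasP; exists pc; first by rewrite mem_iota; lia.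
rewrite Hf; apply/flatten_mapP; exists r; first by rewrite mem_iota; lia.
exact: map_f.
Qed.

Lemma gadget_inv e pc' i : e \in gadget pc' i ->
  exists r' t, [/\ (r' < 3)%N, t \in phase i.1.1 r' & e = inst pc' r' i.1.2 i.2 t].
Proof.
move=> /flatten_mapP [r']; rewrite mem_iota => /andP [_ Hr'] /mapP [t Ht ->].
by exists r', t.
Qed.

Lemma phase_tag o r' t : t \in phase o r' -> (t.1.1.1 < 21)%N.
Proof.
suff /allP H : all (fun t : tmpl => (t.1.1.1 < 21)%N) (phase o r') by move=> /H.
by [].
Qed.

(** A location determines the program counter, the clock roles and the tag, so the controller can
    only choose among the templates of that tag. *)
Lemma edge_inv o lz lp e t : fetch P pc = (o, lz, lp) -> e \in edges A ->
  e_src e = loc pc r t -> (t < 21)%N ->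
  exists2 m, m \in [seq m <- phase o r | m.1.1.1 == t] & e = inst pc r lz lp m.
Proof.
move=> Hf; rewrite (impl_edges HA) => /orP [|/hasP [pc']].
  by rewrite in_cons mem_seq1 => /orP [] /eqP -> E _; exfalso; move: E; rewrite /e_src /loc /=; lia.
rewrite mem_iota => Hpc' /gadget_inv [r' [m [Hr' Hm ->]]].
rewrite e_src_inst => E Ht.
have [E1 E2 E3] := loc_decode pc Hr Ht.
have [E1' E2' E3'] := loc_decode pc' Hr' (phase_tag Hm).
have ? : pc' = pc by rewrite -E1' E E1.
have ? : r' = r by rewrite -E2' E E2.
subst; exists m; last by rewrite Hf.
by rewrite mem_filter -E3' E E3 eqxx; rewrite Hf in Hm.
Qed.

End Edges.

Lemma init_inv A P start e l : implements A P start -> e \in edges A -> e_src e = l ->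
  (l < 2)%N -> e = if l == 0%N then init0 else init1 start.
Proof.
move=> HA; rewrite (impl_edges HA) => /orP [|/hasP [pc']].
  by rewrite in_cons mem_seq1 => /orP [] /eqP -> <-.
rewrite mem_iota => Hpc' /gadget_inv [r' [m [Hr' Hm ->]]].
by rewrite e_src_inst /loc; lia.
Qed.

(* The factor 3 puts the test value 2 strictly between zero and positive
   counters, so that zero tests tolerate small errors. *)
Definition cval (c : nat) : R := 3%:R / 2%:R ^+ c.

Lemma cval0 : cval 0 = 3.
Proof. by rewrite /cval expr0 divr1. Qed.

Lemma cvalS c : cval c = 2 * cval c.+1.
Proof.
by rewrite /cval exprS; field; rewrite expf_neq0 ?pnatr_eq0.
Qed.

Lemma cval_gt0 c : 0 < cval c.
Proof. by rewrite /cval divr_gt0 // exprn_gt0. Qed.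

Lemma cval_le3 c : cval c <= 3.
Proof.
elim: c => [|c IH]; first by rewrite cval0.
by have := cvalS c; have := cval_gt0 c.+1; lra.
Qed.

Lemma cval_pos_le c : (0 < c)%N -> cval c <= 3 / 2.
Proof. by case: c => // c _; have := cvalS c; have := cval_le3 c; lra. Qed.

(** * Checks *)

Definition tmpl0 : tmpl := (0%N, [::], [::], inr 0%N).

Fixpoint ccost (ws : seq wait) (t : nat) (nu : valuation) : R :=
  if ws is w :: ws' then
    (w.1.2%:~R - nu w.1.1) * (nth 0 price_pattern t)%:~R
    + ccost ws' t.+1 (delay_reset nu (w.1.2%:~R - nu w.1.1) w.2)
  else 0.

Lemma ccost_cons w ws t nu : ccost (w :: ws) t nu =
  (w.1.2%:~R - nu w.1.1) * (nth 0 price_pattern t)%:~R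
  + ccost ws t.+1 (delay_reset nu (w.1.2%:~R - nu w.1.1) w.2).
Proof. by []. Qed.

(** The margin 1 absorbs the drift of the clocks and still leaves a delay of at least [delta]. *)
Fixpoint long_waits (ws : seq wait) (nu : valuation) : Prop :=
  if ws is w :: ws' then
    1 <= w.1.2%:~R - nu w.1.1 /\
    long_waits ws' (delay_reset nu (w.1.2%:~R - nu w.1.1) w.2)
  else True.

Definition mult_new (o : op) : R := if o is OInc then 2 else 1.
Definition mult_old (o : op) : R := if o is ODec then 2 else 1.

Lemma cval_op o c : op_ok o c -> mult_new o * cval (app_op o c) = mult_old o * cval c.
Proof.
case: o => /= [_|H|_]; last by [].
  by rewrite (cvalS c) mul1r.
by rewrite (cvalS c.-1) prednK // mul1r.
Qed.

Lemma op_val_uniq o c b : op_ok o c -> mult_new o * b - mult_old o * cval c = 0 ->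
  b = cval (app_op o c).
Proof. by move=> /cval_op; case: o => /=; lra. Qed.

(** The first four waits take 16 time units, after which the active clock stands at [a + 30] and its
    waits for 36 last [6 - a]. The paid waits are [2 + b], then [2 + b] or 2, then [6 - a], then
    [6 - a] or 6, then the pad: 16 + 60 plus the difference. *)
Lemma ccostA o r a b nu : (r < 3)%N -> nu (fre r) = b + 2 -> nu (act r) = a + 14 ->
  nu 4%N = 0 ->
  ccost (waits o r 60) 3 nu = 76 + (mult_new o * b - mult_old o * a).
Proof.
by case: r => [|[|[|//]]] _ Hw Hu Hy; rewrite /fre /act /= in Hw Hu *;
  case: o; rewrite /= /delay_reset /= ?Hw ?Hu ?Hy; lra.
Qed.

Lemma ccostB o r a b nu : (r < 3)%N -> nu (fre r) = b + 2 -> nu (act r) = a + 14 ->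
  nu 4%N = 0 ->
  ccost (waits o r 4) 12 nu = 76 - (mult_new o * b - mult_old o * a).
Proof.
by case: r => [|[|[|//]]] _ Hw Hu Hy; rewrite /fre /act /= in Hw Hu *;
  case: o; rewrite /= /delay_reset /= ?Hw ?Hu ?Hy; lra.
Qed.

Lemma long_waits_check o r pad a b nu : (r < 3)%N -> nu (fre r) = b + 2 ->
  nu (act r) = a + 14 -> nu 4%N = 0 -> 0 <= a <= 3 -> 0 <= b <= 3 -> (0 < pad)%N ->
  long_waits (waits o r pad) nu.
Proof.
move=> Hr Hw Hu Hy Ha Hb Hp.
have Hp' : 1 <= (pad%:Z)%:~R :> R by rewrite -[1]/(1%:~R) ler_int.
move: Hr Hw Hu; case: r => [|[|[|//]]] _ Hw Hu; rewrite /fre /act /= in Hw Hu *;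
  case: o; rewrite /= /delay_reset /= ?Hw ?Hu ?Hy; repeat split; lra.
Qed.

Lemma phase_filter o r t : (3 <= t < 21)%N ->
  [seq m <- phase o r | m.1.1.1 == t] = [:: nth tmpl0 (phase o r) (t + 3)].
Proof. by do 21 (case: t => [//|t]). Qed.

Lemma drop_phaseA o r : drop (3 + 3) (phase o r) = chain 3 (waits o r 60) ++ chain 12 (waits o r 4).
Proof. by []. Qed.

Lemma drop_phaseB o r : drop (12 + 3) (phase o r) = chain 12 (waits o r 4) ++ [::].
Proof. by []. Qed.

Lemma chain_nth o r t w ws rest : drop (t + 3) (phase o r) = chain t (w :: ws) ++ rest ->
  nth tmpl0 (phase o r) (t + 3) =
  (t, [:: (w.1.1, CEq, w.1.2)], w.2, if ws is [::] then inr 0%N else inl t.+1).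
Proof. by move=> H; rewrite -[(t + 3)%N]addn0 -nth_drop H. Qed.

Lemma chain_drop o r t w ws rest : drop (t + 3) (phase o r) = chain t (w :: ws) ++ rest ->
  drop (t.+1 + 3) (phase o r) = chain t.+1 ws ++ rest.
Proof. by move=> H; rewrite -[(t.+1 + 3)%N]/(1 + (t + 3))%N -drop_drop H /= drop0. Qed.

Lemma test_zero c : 10%:Z%:~R < cval c + 7 + 0 + 1 -> c = 0%N.
Proof. by case: c => // c; have Hc := cval_pos_le (ltn0Sn c) => H; exfalso; lra. Qed.

Lemma test_pos c : cval c + 7 + 0 + 1 < 10%:Z%:~R -> c != 0%N.
Proof. by case: c => //; rewrite cval0 => H; exfalso; lra. Qed.

Section Forced.
Variables (A : rpta) (P : seq instr) (start : nat).
Hypothesis HA : implements A P start.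
Variables (delta : R) (s1 : ctrl_strat) (s2 : pert_strat).
Local Notation run := (run A delta s1 s2 (inl 0%N, zero_val)).

Section Phase.
Variables (pc r : nat) (o : op) (lz lp : nat).
Hypotheses (Hpc : (0 < pc <= size P)%N) (Hr : (r < 3)%N).
Hypothesis Hf : fetch P pc = (o, lz, lp).

Lemma forced_step k h nu t : run k = Some h -> cur h = (inl (loc pc r t), nu) ->
  (t < 21)%N -> run k.+1 <> None ->
  let d := (s1 h).1 in let eps := s2 h (s1 h) in let h' := extend h (s1 h) eps in
  run k.+1 = Some h' /\
  exists2 m, m \in [seq m <- phase o r | m.1.1.1 == t] &
    [/\ delta <= d, guard_sat m.1.1.2 (fun x => nu x + d),
      cur h' = (dst pc r lz lp m.2, delay_reset nu (d + eps) m.1.2) &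
      acc_cost A h' = acc_cost A h + (d + eps) * (nth 0 price_pattern t)%:~R].
Proof.
move=> H Hc Ht /run_extend_inv -/(_ _ _ H); rewrite Hc => /(_ _ erefl) [].
move=> /and4P [Hd He /eqP Hs Hg] Hrun; split=> //.
have [m Hm Em] := edge_inv HA Hpc Hr Hf He Hs Ht.
exists m => //; split=> //.
- by rewrite Em in Hg.
- by rewrite cur_extend Hc Em.
- by rewrite acc_extend Hs (impl_eta HA) //; lia.
Qed.

(** An equality guard leaves one delay and each tag of a check has one edge, so an unperturbed check
    is determined up to the target. *)
Lemma chain_forced n : (forall k, run k <> None) ->
  (forall h m, (n <= size h.2)%N -> s2 h m = 0) ->
  forall ws t rest k h nu, (0 < size ws)%N -> (3 <= t)%N -> (t + size ws <= 21)%N ->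
  drop (t + 3) (phase o r) = chain t ws ++ rest ->
  (n <= size h.2)%N -> run k = Some h -> cur h = (inl (loc pc r t), nu) ->
  exists k' h', [/\ run k' = Some h', (cur h').1 = inr 0%N &
    acc_cost A h' = acc_cost A h + ccost ws t nu].
Proof.
move=> Hnone H0; elim=> // w ws IH t rest k h nu _ t3 tsz Hdrop Hn Hrun Hcur.
have tlt : (3 <= t < 21)%N by move: tsz => /=; lia.
have [Hrun' [m]] := forced_step Hrun Hcur (proj2 (andP tlt)) (Hnone _).
rewrite phase_filter // mem_seq1 (chain_nth Hdrop) => /eqP -> [_ /= Hg Hcur' Hacc].
have Hd : (s1 h).1 = w.1.2%:~R - nu w.1.1 by lra.
rewrite H0 // addr0 Hd in Hcur' Hacc.
rewrite H0 // in Hrun'.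
case: ws IH tsz Hdrop Hcur' => [|w' ws] IH tsz Hdrop Hcur'.
  by exists k.+1, (extend h (s1 h) 0); rewrite Hrun' Hcur' Hacc /= addr0.
have [|||k' [h' [Hk' Hh' Ha']]] := IH t.+1 rest k.+1 _ _ isT _ _ (chain_drop Hdrop) _ Hrun' Hcur'.
- by lia.
- by move: tsz => /=; lia.
- by rewrite size_extend; lia.
by exists k', h'; split=> //; rewrite Ha' Hacc -addrA.
Qed.

End Phase.
End Forced.

(** * Cheating controllers lose *)

Section No.
Variables (A : rpta) (P : seq instr) (start : nat).
Hypothesis HA : implements A P start.
Local Notation cfgs j := (iter j (mstep P) (start, 0%N, 0%N)).
Hypothesis Hvalid : forall j, valid P (cfgs j).
Variable s1 : ctrl_strat.
Local Notation run := (fun delta s2 => run A delta s1 s2 (inl 0%N, zero_val)).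
Hypothesis Hlim : limcost_le A fgoal0 s1 (inl 0%N, zero_val) 76.

Definition pert_at (n : nat) (eta : R) : pert_strat :=
  fun h _ => if size h.2 == n then eta else 0.

Lemma pert_at_valid n eta delta : - delta <= eta <= delta -> pert_valid delta (pert_at n eta).
Proof. by move=> H h m; rewrite /pert_at; case: ifP => // _; lra. Qed.

Definition phase_start (j : nat) (h : hist) : Prop :=
  let: (pc, c1, c2) := cfgs j in let r := (j %% 3)%N in
  [/\ size h.2 = (2 + 3 * j)%N, acc_cost A h = 0,
      (cur h).1 = inl (loc pc r 0) &
      [/\ (cur h).2 (act r) = cval c1 + 8, (cur h).2 (pas r) = cval c2 + 2 &
          (cur h).2 3%N = 0]].

(** The second perturbation [eps] is left open: 0 continues the exact simulation, a nonzero value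
    triggers a check. *)
Lemma guess_forced delta s2 j k h o lz lp : phase_start j h ->
  fetch P (cfgs j).1.1 = (o, lz, lp) -> run delta s2 k = Some h ->
  (forall k, run delta s2 k <> None) -> s2 h (s1 h) = 0 ->
  let r := (j %% 3)%N in let b := 4 - (s1 h).1 in
  let h1 := extend h (s1 h) 0 in let eps := s2 h1 (s1 h1) in let h2 := extend h1 (s1 h1) eps in
  [/\ run delta s2 k.+2 = Some h2, size h2.2 = (size h.2).+2, acc_cost A h2 = 0,
      (cur h2).1 = inl (loc (cfgs j).1.1 r 2) &
      [/\ (cur h2).2 (fre r) = b + 1 + eps,
          (cur h2).2 (act r) = cval (cfgs j).1.2 + 13 + eps,
          (cur h2).2 (pas r) = cval (cfgs j).2 + 7 + eps,
          (cur h2).2 3%N = 5 + eps & (cur h2).2 4%N = 0]].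
Proof.
rewrite /phase_start; have := Hvalid j; case E: (cfgs j) => [[pc c1] c2] /= /andP [Hpc _].
move=> [Hs Hacc Hc1 [Ha Hp Hx]] Hf H0 Hnone Heps.
set r := (j %% 3)%N in Ha Hp Hc1 *; have Hr : (r < 3)%N by rewrite ltn_mod.
have Hc : cur h = (inl (loc pc r 0), (cur h).2) by rewrite -Hc1 -surjective_pairing.
have [] := forced_step HA Hpc Hr Hf H0 Hc isT (Hnone _).
rewrite Heps => H1 [m]; rewrite mem_seq1 => /eqP -> [_ _ Hcur1 Hacc1].
set h1 := extend h (s1 h) 0 in H1 Hcur1 Hacc1 *.
have [] := forced_step HA Hpc Hr Hf H1 Hcur1 isT (Hnone _).
set eps := s2 h1 (s1 h1).
move=> H2 [m']; rewrite mem_seq1 => /eqP -> [_ /= Hg Hcur2 Hacc2].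
split=> //.
- by rewrite !size_extend.
- by rewrite Hacc2 Hacc1 Hacc; lra.
- by rewrite Hcur2.
move: Hg; rewrite Hcur2 /= /delay_reset.
move: (r) Hr Ha Hp => [|[|[|//]]] _; rewrite /act /fre /pas /= => Ha Hp.
all: by rewrite andbT => /eqP Hg; split; lra.
Qed.

Section Stuck.
Variable d1 : R.
Hypothesis d1_gt0 : 0 < d1.
Hypothesis never_stuck : forall delta s2, 0 < delta < d1 -> pert_valid delta s2 ->
  forall k, run delta s2 k <> None.
Local Notation still := (fun (_ : hist) (_ : R * edge) => 0 : R).

Lemma still_valid delta : 0 < delta -> pert_valid delta still.
Proof. by move=> H h m; lra. Qed.

(* The play up to the guess does not depend on delta, hence neither does the
   size of the cheat; perturbing the next step by delta or - delta only costs
   the perturbator O(delta) in the check. *)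
Lemma no_cheat j h o lz lp : phase_start j h -> fetch P (cfgs j).1.1 = (o, lz, lp) ->
  (forall delta, 0 < delta < d1 -> run delta still (2 + 3 * j)%N = Some h) ->
  mult_new o * (4 - (s1 h).1) - mult_old o * cval (cfgs j).1.2 = 0.
Proof.
move=> Hh Hf Hrun; set b := 4 - _; set a := cval _.
set d := (X in X = 0); case: (eqVneq d 0) => // dn0; exfalso.
have dabs : 0 < `|d| by rewrite normr_gt0.
have [|d0 [d0_gt0 Hd0]] := Hlim (e := `|d| / 2); first lra.
(* The check will cost at least [76 + |d| - delta], while the limit-cost allows [76 + |d| / 2];
   [|d| / 8] separates the two. *)
pose delta := Num.min (Num.min d0 d1) `|d| / 8.
have Hdelta : [/\ 0 < delta, delta < d0, delta < d1 & delta <= `|d| / 8].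
  have m0 : 0 < Num.min (Num.min d0 d1) `|d| by rewrite !lt_min d0_gt0 d1_gt0.
  have m1 : Num.min (Num.min d0 d1) `|d| <= Num.min d0 d1 by rewrite ge_min lexx.
  have m2 : Num.min d0 d1 <= d0 by rewrite ge_min lexx.
  have m3 : Num.min d0 d1 <= d1 by rewrite ge_min lexx orbT.
  have m4 : Num.min (Num.min d0 d1) `|d| <= `|d| by rewrite ge_min lexx orbT.
  by rewrite /delta; split; lra.
case: Hdelta => dl0 dld0 dld1 dlabs.
(* The sign selects the check in which the cheat raises the cost. The guess is step [2 + 3 * j], so
   the shift falls on the step after it. *)
pose eta := if 0 < d then delta else - delta.
pose s2 := pert_at (2 + 3 * j).+1 eta.
have Hs2 : pert_valid delta s2.
  by apply: pert_at_valid; rewrite /eta; case: ifP => _; lra.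
have Hd1 : 0 < delta < d1 by rewrite dl0.
have Hns := never_stuck Hd1 Hs2.
have Hsz : size h.2 = (2 + 3 * j)%N by move: Hh; rewrite /phase_start; case: (cfgs j) => [[? ?] ?] [].
have H0 : run delta s2 (2 + 3 * j)%N = Some h.
  rewrite -(Hrun _ Hd1); apply: run_same => h' m Hh'.
  by rewrite /s2 /pert_at ltn_eqF // ltnW.
have Heps0 : s2 h (s1 h) = 0 by rewrite /s2 /pert_at Hsz ltn_eqF.
have := guess_forced Hh Hf H0 Hns Heps0.
set r := (j %% 3)%N; set h1 := extend h _ _; cbv zeta.
have -> : s2 h1 (s1 h1) = eta by rewrite /s2 /pert_at size_extend Hsz eqxx.
set h2 := extend h1 _ _.
move=> [H2 sz2 acc2 cur2 [ew eu _ ex ey]].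
have Hr : (r < 3)%N by rewrite ltn_mod.
have Hpc : (0 < (cfgs j).1.1 <= size P)%N.
  by have := Hvalid j; case: (cfgs j) => [[pc c1] c2] /= /andP [].
have Hc2 : cur h2 = (inl (loc (cfgs j).1.1 r 2), (cur h2).2) by rewrite -cur2 -surjective_pairing.
have s20 h' m : ((2 + 3 * j).+2 <= size h'.2)%N -> s2 h' m = 0.
  by move=> Hh'; rewrite /s2 /pert_at gtn_eqF.
have sz2' : ((2 + 3 * j).+2 <= size h2.2)%N by rewrite sz2 Hsz.
have [] := forced_step HA Hpc Hr Hf H2 Hc2 isT (Hns _).
rewrite s20 //; set h3 := extend h2 _ _ => H3 [m Hm [_ Hg cur3 acc3]].
have sz3 : ((2 + 3 * j).+2 <= size h3.2)%N by rewrite size_extend leqW.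
have Hd : (s1 h2).1 = 1.
  move: Hm Hg; rewrite !inE => /or4P [] /eqP -> /= /andP [/eqP]; rewrite ey; lra.
have Hfin : exists k' h', [/\ run delta s2 k' = Some h', (cur h').1 = inr 0%N &
    acc_cost A h' >= 76 + `|d| - delta].
  have Hx : (cur h2).2 3%N + (s1 h2).1 = 6 + eta by rewrite ex Hd; lra.
  rewrite Hd addr0 in cur3.
  have Hacc3 : acc_cost A h3 = 0 by rewrite acc3 acc2; lra.
  have eu' : (cur h2).2 (act r) + 1 = (a + eta) + 14 by rewrite eu /a; lra.
  have ew' : (cur h2).2 (fre r) + 1 = (b + eta) + 2 by rewrite ew /b; lra.
  have nu3 : m.1.2 = [:: 4%N] -> [/\ (cur h3).2 (fre r) = b + eta + 2,
      (cur h3).2 (act r) = a + eta + 14 & (cur h3).2 4%N = 0].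
    rewrite cur3 /delay_reset => -> /=; rewrite -eu' -ew'.
    by move: (r) Hr => [|[|[|//]]].
  (* Both counter clocks are shifted by [eta], so the check measures
     [d + (mult_new o - mult_old o) * eta]. *)
  have Emult : `|(mult_new o - mult_old o) * eta| <= delta.
    have -> : `|(mult_new o - mult_old o) * eta| = `|mult_new o - mult_old o| * delta.
      by rewrite normrM /eta; case: ifP => _; rewrite ?normrN (ger0_norm (ltW dl0)).
    by case: (o) => /=; rewrite ?subrr ?normr0; 
       [rewrite (_ : 2 - 1 = 1) ?normr1 ?(_ : 1 - 2 = -1) ?normrN ?normr1|
        rewrite (_ : 1 - 2 = -1) ?normrN ?normr1|]; lra.
  have /andP [Em1 Em2] : - delta <= (mult_new o - mult_old o) * eta <= delta by rewrite -ler_norml.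
  have Ed : mult_new o * (b + eta) - mult_old o * (a + eta) = d + (mult_new o - mult_old o) * eta.
    by rewrite /d; ring.
  move: Hm Hg; rewrite !inE => /or4P [] /eqP Em; rewrite Em /= Hx => Hg.
  - by exfalso; move: Hg; rewrite /eta; case: ifP => _; lra.
  - by exfalso; move: Hg; rewrite /eta; case: ifP => _; lra.
  - have dpos : 0 < d by move: Hg; rewrite /eta; case: ifP => _; lra.
    have [ew3 eu3 ey3] := nu3 (congr1 (fun m : tmpl => m.1.2) Em).
    have Hc3 : cur h3 = (inl (loc (cfgs j).1.1 r 3), (cur h3).2) by rewrite cur3 Em.
    have [k' [h' [Hk' Hh' Ha']]] :=
      chain_forced HA Hpc Hr Hf Hns s20 (ws := waits o r 60) (t := 3) isT isT isT
        (drop_phaseA o r) sz3 H3 Hc3.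
    exists k', h'; split=> //; rewrite Ha' Hacc3 (ccostA _ Hr ew3 eu3 ey3) Ed (gtr0_norm dpos).
    lra.
  - have dneg : d < 0 by move: Hg dn0; rewrite /eta neq_lt; case: ifP => ?; lra.
    have [ew3 eu3 ey3] := nu3 (congr1 (fun m : tmpl => m.1.2) Em).
    have Hc3 : cur h3 = (inl (loc (cfgs j).1.1 r 12), (cur h3).2) by rewrite cur3 Em.
    have [k' [h' [Hk' Hh' Ha']]] :=
      chain_forced HA Hpc Hr Hf Hns s20 (ws := waits o r 4) (t := 12) isT isT isT
        (drop_phaseB o r) sz3 H3 Hc3.
    exists k', h'; split=> //; rewrite Ha' Hacc3 (ccostB _ Hr ew3 eu3 ey3) Ed (ltr0_norm dneg).
    lra.
case: Hfin => k' [h' [Hk' Hh' Ha']].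
have [k'' [h'' [j'' [Hk'' [Hh'' Ha'']]]]] := Hd0 delta dl0 dld0 s2 Hs2.
have Eh := target_uniq Hk' Hh' Hk'' Hh''.
by move: Ha''; rewrite -Eh /fgoal0; lra.
Qed.

(** [no_cheat] together with [op_val_uniq] turns the forced play into an exact simulation. One
    history serves all [delta] below [d1], since [delta] enters only into the legality of moves. *)
Lemma exact_phase j : exists h, phase_start j h /\
  forall delta, 0 < delta < d1 -> run delta still (2 + 3 * j)%N = Some h.
Proof.
elim: j => [|j [h [Hh Hrun]]].
  have Hd : 0 < d1 / 2 < d1 by move: d1_gt0; lra.
  pose h0 : hist := ((inl 0%N, zero_val), [::]).
  pose h1 := extend h0 (s1 h0) 0; pose h2 := extend h1 (s1 h1) 0.
  have Hlegal delta : 0 < delta < d1 -> [/\ (s1 h0).2 = init0,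
      guard_sat (e_guard init0) (fun x => zero_val x + (s1 h0).1),
      (s1 h1).2 = init1 start,
      guard_sat (e_guard (init1 start)) (fun x => (cur h1).2 x + (s1 h1).1) &
      run delta still 2 = Some h2].
    move=> Hdelta; have Hns := never_stuck Hdelta (still_valid (proj1 (andP Hdelta))).
    have H0 : run delta still 0 = Some h0 by [].
    have [/and4P [_ He0 /eqP Hs0 Hg0] H1] := run_extend_inv H0 erefl (Hns 1%N).
    have E0 : (s1 h0).2 = init0 := init_inv HA He0 Hs0 isT.
    have Hc1 : (cur h1).1 = inl 1%N by rewrite cur_extend E0.
    have [/and4P [_ He1 /eqP Hs1 Hg1] H2] := run_extend_inv H1 Hc1 (Hns 2).
    have E1 : (s1 h1).2 = init1 start := init_inv HA He1 Hs1 isT.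
    by split=> //; rewrite -?E0 -?E1.
  exists h2; split; last by move=> delta /Hlegal [].
  have [E0 Hg0 E1 Hg1 _] := Hlegal _ Hd.
  have A1 : acc_cost A h1 = 0.
    rewrite acc_extend E0 (impl_eta HA (pc := 0) (r := 0) (t := 0)) //.
    by rewrite /acc_cost big_nil; lra.
  have c1 : (cur h1).2 = delay_reset zero_val (s1 h0).1 [:: 1%N].
    by rewrite cur_extend E0 addr0.
  move: Hg0 Hg1; rewrite c1 /= /delay_reset /zero_val /= => Hg0 Hg1.
  split=> //.
  - rewrite acc_extend E1 A1 (impl_eta HA (pc := 0) (r := 0) (t := 1)) //=; lra.
  - by rewrite cur_extend E1.
  - by rewrite cur_extend E1 c1 /= /delay_reset /zero_val /= cval0; split; lra.
have Hsz : size h.2 = (2 + 3 * j)%N by move: Hh; rewrite /phase_start; case: (cfgs j) => [[? ?] ?] [].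
case Hf : (fetch P (cfgs j).1.1) => [[o lz] lp].
have Hnc := no_cheat Hh Hf Hrun.
have Hr : (j %% 3 < 3)%N by rewrite ltn_mod.
have [Hpc Hok] : (0 < (cfgs j).1.1 <= size P)%N /\ op_ok o (cfgs j).1.2.
  by have := Hvalid j; move: Hf; case: (cfgs j) => [[pc c1] c2] /= -> /andP [].
have Eb := op_val_uniq Hok Hnc.
pose h1 := extend h (s1 h) 0; pose h2 := extend h1 (s1 h1) 0; pose h3 := extend h2 (s1 h2) 0.
exists h3.
suff H delta : 0 < delta < d1 -> phase_start j.+1 h3 /\ run delta still (2 + 3 * j.+1)%N = Some h3.
  have Hd : 0 < d1 / 2 < d1 by move: d1_gt0; lra.
  by split; [have [] := H _ Hd | move=> delta /H []].
move=> Hd; have Hns := never_stuck Hd (still_valid (proj1 (andP Hd))).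
have := guess_forced Hh Hf (Hrun _ Hd) Hns erefl.
cbv zeta; rewrite -/h1 -/h2 => -[H2 sz2 acc2 cur2 [ew eu ep ex ey]].
have Hc2 : cur h2 = (inl (loc (cfgs j).1.1 (j %% 3) 2), (cur h2).2) by rewrite -cur2 -surjective_pairing.
have [] := forced_step HA Hpc Hr Hf H2 Hc2 isT (Hns _).
rewrite -/h3 => H3 [m Hm [_ Hg cur3 acc3]].
split; last by rewrite (_ : 2 + 3 * j.+1 = (2 + 3 * j).+3)%N //; lia.
have Hd1 : (s1 h2).1 = 1.
  move: Hm Hg; rewrite !inE => /or4P [] /eqP -> /= /andP [/eqP]; rewrite ey; lra.
rewrite Hd1 addr0 in cur3.
have Hdst : m.1.2 = [:: 3%N] /\ m.2 = inr (if (cfgs j).2 == 0%N then 1%N else 2).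
  have E6 : 5 + 0 + 1 = 6 :> R by lra.
  move: Hm Hg; rewrite !inE => /or4P [] /eqP -> /=; rewrite Hd1 ?ex ?ep E6 => /and3P [_ Hx Hg].
  - by case/andP: Hg => /test_zero ->.
  - by case/andP: Hg => /test_pos /negbTE ->.
  - by rewrite ltxx in Hx.
  - by rewrite ltxx in Hx.
case: Hdst => Hreset Hdst.
have EN : cfgs j.+1 = mstep P (cfgs j) by [].
have Hv := Hvalid j.+1.
have ER : (j.+1 %% 3 = (j %% 3 + 1) %% 3)%N by rewrite modnDml addn1.
rewrite Hreset Hdst in cur3.
have EN' : cfgs j.+1 =
    (if (cfgs j).2 == 0%N then lz else lp, (cfgs j).2, app_op o (cfgs j).1.2).
  by rewrite EN; move: Hf; case: (cfgs j) => [[pc c1] c2] /= ->.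
have Hpc' : (0 < if (cfgs j).2 == 0%N then lz else lp)%N.
  by move: Hv; rewrite EN' => /andP [/andP []].
have Hgoto : dst (cfgs j).1.1 (j %% 3) lz lp (inr (if (cfgs j).2 == 0%N then 1%N else 2)) =
    inl (loc (if (cfgs j).2 == 0%N then lz else lp) ((j %% 3 + 1) %% 3) 0).
  by rewrite /dst /goto; case: ((cfgs j).2 == 0%N) Hpc'; [case: (lz) | case: (lp)].
rewrite /phase_start ER EN' cur3 Hgoto /= /delay_reset.
split=> //.
- by rewrite !size_extend Hsz; clear; lia.
- by rewrite acc3 acc2; lra.
move: (j %% 3)%N Hr eu ep ew ex => [|[|[|//]]] _; rewrite /act /fre /pas /= => eu ep ew ex; split; lra.
Qed.

End Stuck.

Lemma never_halts_no : False.
Proof.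
(* Any finite bound on the cost will do here: it only serves to keep plays from being blocked. *)
have [|d1 [d1_gt0 Hd1]] := Hlim (e := 1); first lra.
have Hns delta s2 : 0 < delta < d1 -> pert_valid delta s2 -> forall k, run delta s2 k <> None.
  move=> /andP [dl0 dld1] /(Hd1 _ dl0 dld1); exact: cost_le_never_stuck.
have Hd : 0 < d1 / 2 < d1 by lra.
have [dl0 dld1] := andP Hd.
have [k [h [j [Hk [Hj _]]]]] := Hd1 _ dl0 dld1 _ (still_valid dl0).
(* A target is reached within [k] steps, yet after [2 + 3 * k] steps the play is still at the start
   of a phase. *)
have [h' [Hh' /(_ _ Hd) Hrun]] := exact_phase d1_gt0 Hns k.
have := run_target (2 + 3 * k - k)%N Hk Hj.
rewrite subnK ?Hrun; last lia.
move=> [Eh]; move: Hh' Hj; rewrite /phase_start Eh.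
by case: (cfgs k) => [[pc c1] c2] [_ _ -> _].
Qed.

End No.

(** * The honest controller *)

(* The guess aims at the exact value of the counter, not at the image of the
   current clock value, so that errors do not accumulate over the phases. *)
Definition honest_move (P : seq instr) (start pc r tag k : nat) (nu : valuation) : R * edge :=
  let: (o, lz, lp) := fetch P pc in
  let mv (d : R) (i : nat) := (d, inst pc r lz lp (nth tmpl0 (phase o r) i)) in
  if tag is t.+3 then
    let w := head (0%N, CEq, 0) (nth tmpl0 (phase o r) (tag + 3)).1.1.2 in
    mv (w.2%:~R - nu w.1.1) (tag + 3)%N
  else if tag is 2 then
    let d := 1 - nu 4%N in
    mv d (if nu 3%N + d == 6 then if 10 < nu (pas r) + d then 2%N else 3%N
          else if 6 < nu 3%N + d then 4%N else 5%N)
  else if tag is 1 then mv (5 - nu 3%N) 1%N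
  else mv (4 - cval (app_op o (iter ((k - 2) %/ 3) (mstep P) (start, 0%N, 0%N)).1.2)) 0%N.

Definition honest (P : seq instr) (start : nat) (h : hist) : R * edge :=
  let nu := (cur h).2 in
  if (cur h).1 is inl l then
    if l is 0 then (6 - nu 0%N, init0)
    else if l is 1 then (11 - nu 0%N, init1 start)
    else honest_move P start (l %/ 63) ((l %% 63) %/ 21) (l %% 21) (size h.2) nu
  else (0, init0).

Lemma price01 t : (nth 0 price_pattern t = 0) \/ (nth 0 price_pattern t = 1).
Proof.
by do 21 (case: t => [|t]; first by [left | right]); rewrite nth_default //; left.
Qed.

(** At the test the passive clock is near 11 for a zero counter and at most about 9.5 otherwise. *)
Lemma near_test c z : `|z - (cval c + 2)| <= 1 / 50 ->
  (10 < z + 6) = (c == 0%N) /\ (z + 6 < 10) = (c != 0%N).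
Proof.
rewrite ler_norml; case: c => [|c] Hz.
  rewrite cval0 in Hz; have H : 10 < z + 6 by lra.
  by rewrite H ltNge (ltW H).
have Hc := cval_pos_le (ltn0Sn c); have H : z + 6 < 10 by lra.
by rewrite H ltNge (ltW H).
Qed.

Section Yes.
Variables (A : rpta) (P : seq instr) (start N : nat).
Hypothesis HA : implements A P start.
Hypothesis Hstart : (0 < start)%N.
Local Notation cfgs j := (iter j (mstep P) (start, 0%N, 0%N)).
Hypothesis Hvalid : forall j, (j < N)%N -> valid P (cfgs j).
Hypothesis Hhalt : (cfgs N).1.1 = 0%N.

Section Fixed.
Variables (delta : R) (s2 : pert_strat).
Hypothesis delta_gt0 : 0 < delta.
Hypothesis delta_le1 : delta <= 1.
Hypothesis Hs2 : pert_valid delta s2.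
Local Notation run := (run A delta (honest P start) s2 (inl 0%N, zero_val)).
Local Notation won := (cost_le A fgoal0 delta (honest P start) s2 (inl 0%N, zero_val)).

Section Phase.
Variables (pc r : nat) (o : op) (lz lp : nat).
Hypotheses (Hpc : (0 < pc <= size P)%N) (Hr : (r < 3)%N).
Hypothesis Hf : fetch P pc = (o, lz, lp).

Lemma honest_step k h nu t d i : run k = Some h -> cur h = (inl (loc pc r t), nu) ->
  (t < 21)%N ->
  honest_move P start pc r t (size h.2) nu = (d, inst pc r lz lp (nth tmpl0 (phase o r) i)) ->
  (i < 24)%N -> (nth tmpl0 (phase o r) i).1.1.1 = t -> delta <= d ->
  guard_sat (nth tmpl0 (phase o r) i).1.1.2 (fun x => nu x + d) ->
  exists eps h', [/\ - delta <= eps <= delta, run k.+1 = Some h', size h'.2 = (size h.2).+1,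
    cur h' = (dst pc r lz lp (nth tmpl0 (phase o r) i).2,
              delay_reset nu (d + eps) (nth tmpl0 (phase o r) i).1.2) &
    acc_cost A h' = acc_cost A h + (d + eps) * (nth 0 price_pattern t)%:~R].
Proof.
move=> H Hc Ht Hmv Hi Htag Hd Hg.
have Hh : honest P start h = (d, inst pc r lz lp (nth tmpl0 (phase o r) i)).
  rewrite /honest Hc /=; have [E1 E2 E3] := loc_decode pc Hr Ht.
  have : (1 < loc pc r t)%N by rewrite /loc; lia.
  by case: (loc _ _ _) E1 E2 E3 => [//|[//|l]] -> -> ->.
have Hin : nth tmpl0 (phase o r) i \in phase o r by apply: mem_nth.
exists (s2 h (honest P start h)), (extend h (honest P start h) (s2 h (honest P start h))).
split.
- exact: Hs2.
- apply: (run_extend (l := loc pc r t) H); first by rewrite Hc.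
  by rewrite Hh Hc /legal /= Hd (phase_edge HA Hpc Hr Hf Hin) e_src_inst Htag eqxx.
- exact: size_extend.
- by rewrite cur_extend Hh Hc.
- by rewrite acc_extend Hh /= e_src_inst Htag (impl_eta HA) //; case/andP: Hpc.
Qed.

(** A delay misses its ideal by at most [E] and the perturbation adds at most [delta <= E], so one
    wait turns a drift [E] into at most [4 * E] and adds at most [2 * E] to the cost. The excess
    sums to a geometric series. *)
Lemma chain_honest ws : forall t rest k h nu nu' E, (0 < size ws)%N -> (3 <= t)%N ->
  (t + size ws <= 21)%N -> drop (t + 3) (phase o r) = chain t ws ++ rest ->
  run k = Some h -> cur h = (inl (loc pc r t), nu) ->
  (forall x, `|nu x - nu' x| <= E) -> delta <= E -> 4 ^+ size ws * E <= 1 / 2 ->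
  long_waits ws nu' ->
  won (acc_cost A h + ccost ws t nu' + (4 ^+ size ws - 1) * E).
Proof.
elim: ws => // w ws IH t rest k h nu nu' E _ t3 tsz Hdrop Hrun Hcur Hcl HdE HE [Hw Hlong].
have dl0 := delta_gt0; have dl1 := delta_le1.
have tlt : (t < 21)%N by move: tsz; clear => /=; lia.
have Hnth := chain_nth Hdrop.
have H4 : 1 <= 4 ^+ size ws :> R by rewrite exprn_ege1 // ler1n.
move: HE; rewrite [size _]/= exprS => HE.
have E8 : E <= 1 / 8.
  have : 4 * E <= 4 * 4 ^+ size ws * E by rewrite ler_pM2r; lra.
  lra.
set d := w.1.2%:~R - nu w.1.1; set d' := w.1.2%:~R - nu' w.1.1.
have /andP [Hd1 Hd2] : - E <= d - d' <= E.
  rewrite -ler_norml; have := Hcl w.1.1; rewrite distrC; congr (_ <= _); congr `|_|.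
  by rewrite /d /d'; ring.
have Hdd : delta <= d by move: Hw; rewrite -/d'; lra.
have Hmv : honest_move P start pc r t (size h.2) nu =
    (d, inst pc r lz lp (nth tmpl0 (phase o r) (t + 3))).
  rewrite /honest_move Hf; case: t t3 {tsz Hdrop Hcur tlt} Hnth => [//|[//|[//|t]]] _ Hnth.
  by rewrite Hnth.
have [|||eps [h' [Heps Hrun' _ Hcur' Hacc']]] := honest_step Hrun Hcur tlt Hmv _ _ Hdd _.
- by move: tlt; clear; lia.
- by rewrite Hnth.
- by rewrite Hnth /= andbT; apply/eqP; rewrite /d; ring.
rewrite Hnth /= in Hcur'.
have Hp : acc_cost A h' <= acc_cost A h + d' * (nth 0 price_pattern t)%:~R + 2 * E.
  by rewrite Hacc'; case: (price01 t) => -> /=; lra.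
have Hcl' x : `|delay_reset nu (d + eps) w.2 x - delay_reset nu' d' w.2 x| <= 4 * E.
  rewrite /delay_reset; case: ifP => _; first by rewrite subrr normr0; lra.
  by have := Hcl x; rewrite !ler_norml; lra.
case: ws IH tsz Hdrop Hcur' Hlong H4 HE {Hnth} => [|w' ws] IH tsz Hdrop Hcur' Hlong H4 HE.
  exists k.+1, h', 0%N; rewrite Hrun' Hcur'; split=> //; split=> //.
  by rewrite /fgoal0 /= expr0 addr0 -/d' in H4 HE *; lra.
have := IH t.+1 rest k.+1 h' _ _ (4 * E) isT _ _ (chain_drop Hdrop) Hrun' Hcur' Hcl' _ _ Hlong.
set n := size (w' :: ws) in H4 HE *.
case=> [||||k' [h'' [j [Hk' [Hj Hc]]]]].
- by move: t3; clear; lia.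
- by rewrite /n; move: tsz; clear => /=; lia.
- by lra.
- by lra.
exists k', h'', j; split=> //; split=> //.
apply: le_trans Hc _; rewrite (ccost_cons w) -/d'.
have : 0 <= 4 ^+ n * E by rewrite mulr_ge0 ?exprn_ge0 //; lra.
lra.
Qed.

End Phase.

Variable e : R.
Hypothesis small : 4 ^+ 9 * (5 * delta) <= 1 / 2.
Hypothesis small_e : 4 ^+ 9 * (5 * delta) <= e.

(** A passive value has met two perturbations, at its guess and at the end of that phase; one more
    phase adds a third, and the value is then dropped. [goto] makes the case of a halted machine the
    target itself. *)
Definition near_start (j : nat) (h : hist) : Prop :=
  let: (pc, c1, c2) := cfgs j in let r := (j %% 3)%N in
  [/\ size h.2 = (2 + 3 * j)%N, acc_cost A h = 0,
      (cur h).1 = goto pc r &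
      [/\ `|(cur h).2 (act r) - (cval c1 + 8)| <= 3 * delta,
          `|(cur h).2 (pas r) - (cval c2 + 2)| <= 2 * delta & (cur h).2 3%N = 0]].

Lemma check_won k h pc r o lz lp t pad rest c : run k = Some h -> (0 < pc <= size P)%N -> (r < 3)%N ->
  fetch P pc = (o, lz, lp) -> (cur h).1 = inl (loc pc r t) -> acc_cost A h = 0 ->
  op_ok o c -> `|(cur h).2 (act r) - (cval c + 14)| <= 5 * delta ->
  `|(cur h).2 (fre r) - (cval (app_op o c) + 2)| <= 5 * delta -> (cur h).2 4%N = 0 ->
  (t = 3 /\ pad = 60)%N \/ (t = 12 /\ pad = 4)%N ->
  drop (t + 3) (phase o r) = chain t (waits o r pad) ++ rest ->
  won (76 + e).
Proof.
move=> Hrun Hpc Hr Hf Hcur Hacc Hok Ha Hb Hy Htp Hdrop.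
set nu := (cur h).2 in Ha Hb Hy.
have Hcur' : cur h = (inl (loc pc r t), nu) by rewrite -Hcur -surjective_pairing.
(* The ideal valuation corrects only the two clocks that the check reads, and its cost is exactly
   76. *)
pose nu' : valuation := fun x => if x == fre r then cval (app_op o c) + 2
  else if x == act r then cval c + 14 else nu x.
have nw : nu' (fre r) = cval (app_op o c) + 2 by rewrite /nu' eqxx.
have nact : nu' (act r) = cval c + 14.
  by rewrite /nu'; move: (r) Hr => [|[|[|//]]].
have n4 : nu' 4%N = 0.
  by rewrite -Hy /nu'; move: (r) Hr => [|[|[|//]]].
have dl0 := delta_gt0.
have Hcl x : `|nu x - nu' x| <= 5 * delta.
  rewrite /nu'; case: eqP => [->|_] //; case: eqP => [->|_] //.
  by rewrite subrr normr0; lra.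
have cv0 i : 0 <= cval i <= 3 by rewrite cval_le3 (ltW (cval_gt0 _)).
have pad0 : (0 < pad)%N by case: Htp => -[_ ->].
have Hlong := long_waits_check o Hr nw nact n4 (cv0 _) (cv0 _) pad0.
have [t3 tsz] : (3 <= t)%N /\ (t + size (waits o r pad) <= 21)%N by case: Htp => -[-> _].
have Hcost : ccost (waits o r pad) t nu' = 76.
  have Ev := cval_op Hok.
  case: Htp => -[Et Ep]; rewrite Et Ep.
    by rewrite (ccostA o Hr nw nact n4) Ev subrr addr0.
  by rewrite (ccostB o Hr nw nact n4) Ev subrr subr0.
have [|k' [h' [j [Hk' [Hj Hc]]]]] :=
  chain_honest Hpc Hr Hf (ws := waits o r pad) isT t3 tsz Hdrop Hrun Hcur' Hcl _ small Hlong.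
  by lra.
exists k', h', j; split=> //; split=> //; apply: le_trans Hc _.
by rewrite Hacc Hcost add0r; have se := small_e; move: se; rewrite [size _]/=; lra.
Qed.

Lemma honest_phase j k h : (j < N)%N -> near_start j h -> run k = Some h ->
  won (76 + e) \/ exists h', run k.+3 = Some h' /\ near_start j.+1 h'.
Proof.
move=> jN; rewrite /near_start; have := Hvalid jN; case E: (cfgs j) => [[pc c1] c2] /= /andP [Hpc].
case Hf: (fetch P pc) => [[o lz] lp] /= Hok [Hs Hacc Hc1 [Ha Hp Hx]] H0.
set r := (j %% 3)%N in Ha Hp Hc1 *; have Hr : (r < 3)%N by rewrite ltn_mod.
have dl0 := delta_gt0; have sm := small.
have dl3 : delta <= 1 / 100 by lra.
have Hc : cur h = (inl (loc pc r 0), (cur h).2).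
  by rewrite [LHS]surjective_pairing Hc1; case: (pc) Hpc.
set nu := (cur h).2 in Ha Hp Hx Hc; set b := cval (app_op o c1).
have b3 : 0 <= b <= 3 by rewrite cval_le3 (ltW (cval_gt0 _)).
have Hm0 : honest_move P start pc r 0 (size h.2) nu = (4 - b, inst pc r lz lp (nth tmpl0 (phase o r) 0)).
  (* Two initial steps and three per phase: the length of the history reveals the phase. *)
  by rewrite /honest_move Hf Hs (_ : (2 + 3 * j - 2) %/ 3 = j)%N ?E // addKn mulKn.
have [||||e1 [h1 [He1 H1 Hs1 Hcur1 Hacc1]]] := honest_step Hpc Hr Hf H0 Hc isT Hm0 _ _ _ _; try done.
  by lra.
rewrite [nth _ _ _]/= in Hcur1.
set nu1 := delay_reset _ _ _ in Hcur1.
have x1 : nu1 3%N = 4 - b + e1.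
  by rewrite /nu1 /delay_reset; move: (r) Hr => [|[|[|//]]] _; rewrite /= Hx; lra.
have Hm1 : honest_move P start pc r 1 (size h1.2) nu1 =
    (5 - nu1 3%N, inst pc r lz lp (nth tmpl0 (phase o r) 1)).
  by rewrite /honest_move Hf.
have [||||e2 [h2 [He2 H2 Hs2' Hcur2 Hacc2]]] := honest_step Hpc Hr Hf H1 Hcur1 isT Hm1 _ _ _ _; try done.
- by rewrite x1; lra.
- by rewrite /= andbT; apply/eqP; ring.
rewrite [nth _ _ _]/= in Hcur2.
set nu2 := delay_reset _ _ _ in Hcur2.
have y2 : nu2 4%N = 0 by [].
have x2 : nu2 3%N = 5 + e2.
  by rewrite /nu2 /delay_reset /=; ring.
have w2 : nu2 (fre r) = b + 1 - e1 + e2.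
  rewrite /nu2 /delay_reset x1; have -> : (fre r \in [:: 4%N]) = false by move: (r) Hr => [|[|[|//]]].
  by rewrite /nu1 /delay_reset mem_head; ring.
have u2 : nu2 (act r) = nu (act r) + 5 + e2.
  rewrite /nu2 /delay_reset x1; have -> : (act r \in [:: 4%N]) = false by move: (r) Hr => [|[|[|//]]].
  rewrite /nu1 /delay_reset; have -> : (act r \in [:: fre r]) = false by move: (r) Hr => [|[|[|//]]].
  by ring.
have p2 : nu2 (pas r) = nu (pas r) + 5 + e2.
  rewrite /nu2 /delay_reset x1; have -> : (pas r \in [:: 4%N]) = false by move: (r) Hr => [|[|[|//]]].
  rewrite /nu1 /delay_reset; have -> : (pas r \in [:: fre r]) = false by move: (r) Hr => [|[|[|//]]].
  by ring.
have Hacc2' : acc_cost A h2 = 0 by rewrite Hacc2 Hacc1 Hacc /= !mulr0 !addr0.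
have Ha' := Ha; rewrite ler_norml in Ha'; have Hp' := Hp; rewrite ler_norml in Hp'.
have Hm2 i : (if nu2 3%N + 1 == 6 then if 10 < nu2 (pas r) + 1 then 2%N else 3%N
          else if 6 < nu2 3%N + 1 then 4%N else 5%N) = i ->
    honest_move P start pc r 2 (size h2.2) nu2 = (1, inst pc r lz lp (nth tmpl0 (phase o r) i)).
  by rewrite /honest_move Hf y2 subr0 => ->.
have step3 i : (if nu2 3%N + 1 == 6 then if 10 < nu2 (pas r) + 1 then 2%N else 3%N
          else if 6 < nu2 3%N + 1 then 4%N else 5%N) = i -> (i < 24)%N ->
    (nth tmpl0 (phase o r) i).1.1.1 = 2%N ->
    guard_sat (nth tmpl0 (phase o r) i).1.1.2 (fun x => nu2 x + 1) ->
    exists eps h', [/\ - delta <= eps <= delta, run k.+3 = Some h', size h'.2 = (size h2.2).+1,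
    cur h' = (dst pc r lz lp (nth tmpl0 (phase o r) i).2,
              delay_reset nu2 (1 + eps) (nth tmpl0 (phase o r) i).1.2) &
    acc_cost A h' = 0].
  move=> Hi i24 Htag Hg.
  have [|eps [h' [? ? ? ? Ha3]]] := honest_step Hpc Hr Hf H2 Hcur2 isT (Hm2 _ Hi) i24 Htag _ Hg; first lra.
  by exists eps, h'; split=> //; rewrite Ha3 Hacc2' /= mulr0 addr0.
have check eps h' t : - delta <= eps <= delta -> run k.+3 = Some h' -> 
    cur h' = (inl (loc pc r t), delay_reset nu2 (1 + eps) [:: 4%N]) -> acc_cost A h' = 0 ->
    t = 3%N \/ t = 12%N -> won (76 + e).
  move=> Heps H3 Hcur3 Hacc3 Ht.
  have A3 : `|(cur h').2 (act r) - (cval c1 + 14)| <= 5 * delta.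
    rewrite Hcur3 /delay_reset /=; have -> : (act r \in [:: 4%N]) = false by move: (r) Hr => [|[|[|//]]].
    by rewrite u2 ler_norml; lra.
  have B3 : `|(cur h').2 (fre r) - (b + 2)| <= 5 * delta.
    rewrite Hcur3 /delay_reset /=; have -> : (fre r \in [:: 4%N]) = false by move: (r) Hr => [|[|[|//]]].
    by rewrite w2 ler_norml; lra.
  have Y3 : (cur h').2 4%N = 0 by rewrite Hcur3.
  have C3 : (cur h').1 = inl (loc pc r t) by rewrite Hcur3.
  case: Ht => Et; rewrite Et in C3.
    exact: (check_won (pad := 60) H3 Hpc Hr Hf C3 Hacc3 Hok A3 B3 Y3
      (or_introl (conj erefl erefl)) (drop_phaseA o r)).
  exact: (check_won (pad := 4) H3 Hpc Hr Hf C3 Hacc3 Hok A3 B3 Y3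
    (or_intror (conj erefl erefl)) (drop_phaseB o r)).
(* [e2] is what the controller reads off the clocks 3 and 4. Nonzero, it leads to a check; zero, it
   adds nothing to the drift passed on to the next phase. *)
have [e20|e2n0] := eqVneq e2 0; last first.
  left; have ne6 : (nu2 3%N + 1 == 6) = false by apply/eqP; rewrite x2 => ?; move/eqP: e2n0; apply; lra.
  case: (ltP 6 (nu2 3%N + 1)) => H6.
    have [||//||eps [h' [He3 H3 _ Hc3 Ha3]]] := step3 4%N; rewrite ?ne6 ?H6 //.
      by rewrite /= y2 add0r eqxx H6.
    by apply: (check eps h' 3%N) => //; left.
  have H6' : nu2 3%N + 1 < 6 by rewrite lt_neqAle ne6.
  have [||//||eps [h' [He3 H3 _ Hc3 Ha3]]] := step3 5%N; rewrite ?ne6 ?(ltNge 6) ?H6 //.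
    by rewrite /= y2 add0r eqxx H6'.
  by apply: (check eps h' 12%N) => //; right.
right; have eq6 : nu2 3%N + 1 = 6 by rewrite x2 e20; ring.
pose i := if c2 == 0%N then 2%N else 3%N.
have Hz : `|nu (pas r) - (cval c2 + 2)| <= 1 / 50 by rewrite ler_norml; lra.
have Ep : nu2 (pas r) + 1 = nu (pas r) + 6 by rewrite p2 e20; ring.
have [Htest Htest'] := near_test Hz; rewrite -Ep in Htest Htest'.
have [||||eps [h' [He3 H3 Hs3 Hc3 Ha3]]] := step3 i.
- by rewrite eq6 eqxx Htest.
- by rewrite /i; case: ifP.
- by rewrite /i; case: ifP.
- by rewrite /i -Htest; case: ifP => Ht /=; rewrite y2 add0r eq6 !eqxx ?Ht // Htest' -Htest Ht.
exists h'; split=> //.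
rewrite E /= Hf.
have -> : (j.+1 %% 3 = (r + 1) %% 3)%N by rewrite modnDml addn1.
have Hreset : (nth tmpl0 (phase o r) i).1.2 = [:: 3%N] by rewrite /i; case: ifP.
have Hdst : dst pc r lz lp (nth tmpl0 (phase o r) i).2 = goto (if c2 == 0%N then lz else lp) ((r + 1) %% 3).
  by rewrite /i; case: (c2 == 0%N).
rewrite Hreset Hdst in Hc3.
split=> //.
- by rewrite Hs3 Hs2' Hs1 Hs; clear; lia.
- by rewrite Hc3.
rewrite Hc3 /=.
have Epas : act ((r + 1) %% 3) = pas r by [].
have Efre : pas ((r + 1) %% 3) = fre r by rewrite /pas modnDml -addnA.
rewrite Epas Efre /delay_reset.
have -> : (pas r \in [:: 3%N]) = false by move: (r) Hr => [|[|[|//]]].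
have -> : (fre r \in [:: 3%N]) = false by move: (r) Hr => [|[|[|//]]].
by rewrite p2 w2 e20 !ler_norml -/b; split=> //; lra.
Qed.

Lemma honest_init : exists h, run 2 = Some h /\ near_start 0 h.
Proof.
pose h0 : hist := ((inl 0%N, zero_val), [::]).
have sm := small; have dl0 := delta_gt0.
have H0 : run 0 = Some h0 by [].
have E0 : init0 \in edges A by rewrite (impl_edges HA) in_cons eqxx.
have E1 : init1 start \in edges A by rewrite (impl_edges HA) !in_cons eqxx orbT.
set h1 := extend h0 (honest P start h0) (s2 h0 (honest P start h0)).
have H1 : run 1 = Some h1.
  apply: run_extend H0 erefl _; rewrite /legal /= E0 ?eqxx /zero_val /= andbT.
  by apply/andP; split; [lra | apply/eqP; ring].
have Hc1 : cur h1 = (inl 1%N, delay_reset zero_val (6 + s2 h0 (honest P start h0)) [:: 1%N]).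
  by rewrite cur_extend /= /zero_val subr0.
have /andP [ea eb] := Hs2 h0 (honest P start h0).
set e1 := s2 _ _ in h1 H1 Hc1 ea eb.
have c1 : (cur h1).1 = inl 1%N by rewrite Hc1.
set h2 := extend h1 (honest P start h1) (s2 h1 (honest P start h1)).
have Hh1 : honest P start h1 = (5 - e1, init1 start).
  by rewrite /honest Hc1 /= /delay_reset /zero_val /=; congr (_, _); ring.
have H2 : run 2 = Some h2.
  apply: run_extend H1 c1 _; rewrite Hh1 Hc1 /legal /= E1 ?eqxx /zero_val /delay_reset /= andbT.
  by apply/andP; split; [lra | apply/eqP; ring].
exists h2; split=> //; rewrite /near_start.
have /andP [ec ed] := Hs2 h1 (honest P start h1).
set e2 := s2 _ _ in h2 H2 ec ed *.
have A1 : acc_cost A h1 = 0.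
  rewrite acc_extend /= (impl_eta HA (pc := 0) (r := 0) (t := 0)) //.
  by rewrite /acc_cost big_nil /= mulr0 addr0.
split=> //.
- by rewrite acc_extend A1 Hh1 /= (impl_eta HA (pc := 0) (r := 0) (t := 1)) //= mulr0 addr0.
- by rewrite cur_extend Hh1 /=; case: (start) Hstart.
- by rewrite cur_extend Hh1 Hc1 /= /delay_reset /zero_val /= cval0 !ler_norml; split=> //; lra.
Qed.

Lemma honest_won : won (76 + e).
Proof.
have [h [H2 Hh]] := honest_init.
have sm := small; have sme := small_e; have dl0 := delta_gt0.
have H n : (n <= N)%N -> won (76 + e) \/ exists h, run (2 + 3 * n)%N = Some h /\ near_start n h.
  elim: n => [|n IH] nN; first by right; exists h.
  have [|[h' [Hr' Hh']]] := IH (ltnW nN); first by left.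
  have [|[h'' [Hr'' Hh'']]] := honest_phase nN Hh' Hr'; first by left.
  by right; exists h''; split=> //; rewrite -Hr''; congr (run _); clear; lia.
have [//|[h' [Hr' Hh']]] := H N (leqnn N).
exists (2 + 3 * N)%N, h', 0%N; split=> //.
move: Hh' Hhalt; rewrite /near_start; case: (cfgs N) => [[pc c1] c2] /= [_ -> -> _] ->.
by split=> //; rewrite /fgoal0; lra.
Qed.

End Fixed.

Lemma halts_yes : limcost_le A fgoal0 (honest P start) (inl 0%N, zero_val) 76.
Proof.
(* A check has 9 waits and is entered with a drift of at most [5 * delta]. *)
move=> e e0; pose K : R := 4 ^+ 9 * 5.
have K0 : 0 < K by rewrite mulr_gt0 // exprn_gt0.
exists (Num.min (1 / 2) e / K); split.
  by rewrite divr_gt0 // lt_min e0 andbT; lra.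
move=> delta dl0 dld s2 Hs2.
have Hm : 4 ^+ 9 * (5 * delta) <= Num.min (1 / 2) e.
  by rewrite mulrA mulrC -ler_pdivlMr // ltW.
move: Hm; rewrite le_min => /andP [Hm1 Hm2].
apply: (honest_won dl0 _ Hs2 Hm1 Hm2).
have : 1 <= 4 ^+ 9 :> R by rewrite exprn_ege1 // ler1n.
lra.
Qed.

End Yes.

Local Close Scope ring_scope.

(** * Computing the instance *)

Lemma iteriS T n (f : nat -> T -> T) x : iteri n.+1 f x = f n (iteri n f x).
Proof. by []. Qed.

Definition computes k (F : seq nat -> nat) :=
  exists c, forall v, size v = k -> eval c v (F v).

Lemma computes_ext k F G : computes k F -> (forall v, size v = k -> F v = G v) ->
  computes k G.
Proof. by move=> [c H] E; exists c => v Hv; rewrite -E //; apply: H. Qed.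

Lemma computes_const k n : computes k (fun=> n).
Proof.
elim: n => [|n [c H]]; first by exists CZero => v _; apply: ev_zero.
exists (CComp CSucc [:: c]) => v Hv.
apply: ev_comp (ev_succ n [::]); apply: evs_cons; [exact: H | exact: evs_nil].
Qed.

Lemma computes_proj k i : i < k -> computes k (fun v => nth 0 v i).
Proof. by move=> ik; exists (CProj i) => v Hv; apply: ev_proj; rewrite Hv. Qed.

Lemma computes_comp k m F (Gs : seq (seq nat -> nat)) : computes m F -> size Gs = m ->
  (forall i, i < m -> computes k (nth (fun=> 0) Gs i)) ->
  computes k (fun v => F [seq G v | G <- Gs]).
Proof.
move=> [c Hc] Hm HG.
have [gs Hgs] : exists gs, forall v, size v = k -> evals gs v [seq G v | G <- Gs].
  elim: Gs m {c Hc} Hm HG => [|G Gs IH] m Hm HG.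
    by exists [::] => v _; apply: evs_nil.
  have [|gs Hgs] := IH (size Gs) erefl.
    by move=> i Hi; apply: (HG i.+1); rewrite -Hm.
  have [|g Hg] := HG 0; first by rewrite -Hm.
  by exists (g :: gs) => v Hv; apply: evs_cons; [apply: Hg | apply: Hgs].
by exists (CComp c gs) => v Hv; apply: ev_comp (Hgs _ Hv) _; apply: Hc; rewrite size_map.
Qed.

Lemma computes_succ k F : computes k F -> computes k (fun v => (F v).+1).
Proof.
move=> HF.
have HS : computes 1 (fun v => (head 0 v).+1).
  by exists CSucc => -[|x []] // _; apply: ev_succ.
by apply: (computes_comp (Gs := [:: F]) HS) => // -[|].
Qed.

Lemma computes_drop k m F : computes k F -> computes (m + k) (fun v => F (drop m v)).
Proof.
move=> HF; pose Gs := [seq (fun v => nth 0 v i) | i <- iota m k].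
apply: computes_ext (computes_comp (k := m + k) (Gs := Gs) HF _ _) _.
- by rewrite size_map size_iota.
- move=> i ik; rewrite (nth_map 0) ?size_iota // nth_iota //.
  by apply: computes_proj; rewrite ltn_add2l.
- move=> v Hv; congr F; apply: (@eq_from_nth _ 0).
    by rewrite !size_map size_iota size_drop Hv addKn.
  move=> i; rewrite !size_map size_iota => ik.
  by rewrite (nth_map (fun=> 0)) ?size_map ?size_iota // (nth_map 0) ?size_iota // nth_iota // nth_drop.
Qed.

Lemma computes_iter k N B S : computes k N -> computes k B -> computes k.+2 S ->
  computes k (fun v => iteri (N v) (fun i acc => S [:: i, acc & v]) (B v)).
Proof.
move=> HN [b Hb] [s Hs].
have HR : computes k.+1 (fun v => iteri (head 0 v) (fun i acc => S [:: i, acc & behead v]) (B (behead v))).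
  exists (CPrimRec b s) => -[//|n v] [Hv] /=.
  elim: n => [|n IH] /=; first by apply: ev_rec0; apply: Hb.
  by apply: ev_recS IH _; apply: Hs; rewrite /= Hv.
pose Gs := N :: [seq (fun v => nth 0 v i) | i <- iota 0 k].
apply: computes_ext (computes_comp (Gs := Gs) HR _ _) _.
- by rewrite /= size_map size_iota.
- case=> [|i] //= ik; rewrite (nth_map 0) ?size_iota // nth_iota //.
  exact: computes_proj.
- move=> v Hv /=; have -> // : [seq G v | G <- [seq (fun v => nth 0 v i) | i <- iota 0 k]] = v.
  apply: (@eq_from_nth _ 0) => [|i]; rewrite !size_map size_iota ?Hv // => ik.
  by rewrite (nth_map (fun=> 0)) ?size_map ?size_iota // (nth_map 0) ?size_iota // nth_iota.
Qed.

Lemma computes_add k F G : computes k F -> computes k G -> computes k (fun v => F v + G v).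
Proof.
move=> HF HG.
have HS : computes k.+2 (fun w => (nth 0 w 1).+1).
  by apply: computes_succ; apply: computes_proj.
apply: computes_ext (computes_iter HF HG HS) _ => v _ /=.
by elim: (F v) => //= n ->.
Qed.

Lemma computes_mul k F G : computes k F -> computes k G -> computes k (fun v => F v * G v).
Proof.
move=> HF HG.
have HS : computes k.+2 (fun w => nth 0 w 1 + G (drop 2 w)).
  by apply: computes_add; [apply: computes_proj | apply: (computes_drop 2 HG)].
apply: computes_ext (computes_iter HF (computes_const k 0) HS) _ => v _ /=.
by elim: (F v) => //= n ->; rewrite drop0 mulSn addnC.
Qed.

Lemma computes_exp k b F : computes k F -> computes k (fun v => b ^ F v).
Proof.
move=> HF.
have HS : computes k.+2 (fun w => b * nth 0 w 1).
  by apply: computes_mul; [apply: computes_const | apply: computes_proj].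
apply: computes_ext (computes_iter HF (computes_const k 1) HS) _ => v _ /=.
by elim: (F v) => //= n ->; rewrite expnS.
Qed.

(* [CodeSeq.code] is [foldr consN 0], and the product and sum encodings behind
   [pickle] are built from it. *)
Definition consN x m := 2 ^ x * m.*2.+1.
Definition pairN x y := consN x (consN y 0).

Lemma computes_cons k F G : computes k F -> computes k G ->
  computes k (fun v => consN (F v) (G v)).
Proof.
move=> HF HG; apply: computes_mul; first exact: computes_exp.
by apply: computes_succ; apply: computes_ext (computes_add HG HG) _ => v _; rewrite addnn.
Qed.

Lemma computes_pair k F G : computes k F -> computes k G ->
  computes k (fun v => pairN (F v) (G v)).
Proof.
move=> HF HG; apply: computes_cons => //; apply: computes_cons => //; exact: computes_const.
Qed.

Lemma pickle_pair (T U : countType) (x : T) (y : U) :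
  pickle (x, y) = pairN (pickle x) (pickle y).
Proof. by []. Qed.

Lemma pickle_cons (T : countType) (x : T) s : pickle (x :: s) = consN (pickle x) (pickle s).
Proof. by []. Qed.

Lemma pickle_inl (x : nat) : pickle (inl x : nat + nat) = pairN (consN x 0) 0.
Proof. by []. Qed.

(** Prepending depends on the tail only through its code, so the edges of the program can enter the
    computation as a single number. *)
Definition pickle_onto (T : countType) (s : seq T) m := foldr (fun x => consN (pickle x)) m s.

Lemma pickle_cat (T : countType) (s1 s2 : seq T) : pickle (s1 ++ s2) = pickle_onto s1 (pickle s2).
Proof. by elim: s1 => //= x s1 <-; rewrite pickle_cons. Qed.

Lemma pickle_iteri_cat (T : countType) (B : nat -> seq T) n s :
  pickle (iteri n (fun i s' => B i ++ s') s) =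
  iteri n (fun i => pickle_onto (B i)) (pickle s).
Proof. by elim: n => // n IH; rewrite !iteriS pickle_cat IH. Qed.

Lemma pickle_onto_cat (T : countType) (s1 s2 : seq T) m :
  pickle_onto (s1 ++ s2) m = pickle_onto s1 (pickle_onto s2 m).
Proof. exact: foldr_cat. Qed.

Lemma computes_loc k PC r t : computes k PC -> computes k (fun v => loc (PC v) r t).
Proof.
move=> H; apply: computes_add; last exact: computes_const.
by apply: computes_add; [apply: computes_mul | ]; try apply: computes_const.
Qed.

(** With targets written as successors, [goto] reduces without a case on 0: start-up instructions
    never halt. *)
Lemma computes_inst k PC NX r t : computes k PC -> computes k NX ->
  computes k (fun v => pickle (inst (PC v) r (NX v).+1 (NX v).+1 t)).
Proof.
move=> HP HN; have HN' := computes_succ HN.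
apply: computes_pair.
  apply: computes_pair; last exact: computes_const.
  by apply: computes_pair; [apply: computes_loc | apply: computes_const].
have Hinl r' t' F : computes k F -> computes k (fun v => pickle (inl (loc (F v) r' t') : nat + nat)).
  move=> HF; apply: (@computes_ext _ (fun v => pairN (consN (loc (F v) r' t') 0) 0)) => //.
  apply: computes_pair; last exact: computes_const.
  by apply: computes_cons; [apply: computes_loc | apply: computes_const].
change (computes k (fun v => pickle (dst (PC v) r (NX v).+1 (NX v).+1 t.2))).
case: t.2 => [t'|[|[|j]]];
  [exact: (Hinl r t' _ HP) | exact: (computes_const _ (pickle (inr 0 : nat + nat)))
  | exact: (Hinl _ 0 _ HN') | exact: (Hinl _ 0 _ HN')].
Qed.

Lemma gadget_cat pc o lz lp : gadget pc (o, lz, lp) =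
  [seq inst pc 0 lz lp t | t <- phase o 0] ++ [seq inst pc 1 lz lp t | t <- phase o 1]
  ++ [seq inst pc 2 lz lp t | t <- phase o 2].
Proof. by rewrite -[X in _ ++ _ ++ X]cats0. Qed.

Lemma computes_gadget k o PC NX M : computes k PC -> computes k NX -> computes k M ->
  computes k (fun v => pickle_onto (gadget (PC v) (o, (NX v).+1, (NX v).+1)) (M v)).
Proof.
move=> HP HN HM.
have Hmap r (ts : seq tmpl) M' : computes k M' -> computes k (fun v =>
    pickle_onto [seq inst (PC v) r (NX v).+1 (NX v).+1 t | t <- ts] (M' v)).
  move=> HM'; elim: ts => //= t ts IH; apply: computes_cons => //; exact: computes_inst.
apply: (@computes_ext _ (fun v => pickle_onto [seq inst (PC v) 0 (NX v).+1 (NX v).+1 t | t <- phase o 0]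
  (pickle_onto [seq inst (PC v) 1 (NX v).+1 (NX v).+1 t | t <- phase o 1]
  (pickle_onto [seq inst (PC v) 2 (NX v).+1 (NX v).+1 t | t <- phase o 2] (M v))))).
  exact: (Hmap _ _ _ (Hmap _ _ _ (Hmap _ _ _ HM))).
by move=> v _; rewrite gadget_cat !pickle_onto_cat.
Qed.

(** * Start-up phases and the encoding of the whole automaton *)

(* Each of the n added pairs of instructions increments the first counter, so
   that the program starts with input n. *)
Fixpoint chain_prog (P : seq instr) (n : nat) : seq instr :=
  if n is n'.+1 then
    chain_prog P n' ++ [:: (OInc, size P + n'.*2 + 2, size P + n'.*2 + 2);
                           (OKeep, (size P + n'.*2).-1, (size P + n'.*2).-1)]
  else P.

Lemma chain_progS P n : chain_prog P n.+1 =
  chain_prog P n ++ [:: (OInc, size P + n.*2 + 2, size P + n.*2 + 2);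
                        (OKeep, (size P + n.*2).-1, (size P + n.*2).-1)].
Proof. by []. Qed.

Lemma size_chain_prog P n : size (chain_prog P n) = size P + n.*2.
Proof. by elim: n => [|n IH] /=; rewrite ?addn0 // size_cat IH /=; lia. Qed.

Definition gadgets (P : seq instr) : seq edge :=
  flatten [seq gadget pc (fetch P pc) | pc <- iota 1 (size P)].

Lemma fetch_cat P Q pc : 0 < pc <= size P -> fetch (P ++ Q) pc = fetch P pc.
Proof. by case: pc => // pc /= H; rewrite /fetch nth_cat H. Qed.

Lemma mem_gadgets P e :
  (e \in gadgets P) = has (fun pc => e \in gadget pc (fetch P pc)) (iota 1 (size P)).
Proof. by apply/flatten_mapP/hasP => -[pc H1 H2]; exists pc. Qed.

Lemma gadgets_cat2 P i1 i2 : gadgets (P ++ [:: i1; i2]) =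
  gadgets P ++ gadget (size P).+1 i1 ++ gadget (size P).+2 i2.
Proof.
rewrite /gadgets size_cat iotaD map_cat flatten_cat; congr (flatten _ ++ _).
  by apply/eq_in_map => pc; rewrite mem_iota => H; rewrite fetch_cat //; lia.
have F1 : fetch (P ++ [:: i1; i2]) (size P).+1 = i1 by rewrite /fetch nth_cat ltnn subnn.
have F2 : fetch (P ++ [:: i1; i2]) (size P).+2 = i2.
  by rewrite /fetch nth_cat ltnNge leqnSn subSnn.
set Q := P ++ _ in F1 F2 *.
have -> : iota (1 + size P) (size [:: i1; i2]) = [:: (size P).+1; (size P).+2] by [].
by rewrite (map_cons _ (size P).+1) (map_cons _ (size P).+2) F1 F2 -[X in _ ++ X]cats0.
Qed.

(** The edges of the [i]-th added pair behind a program of length [L + 2]; the shift by 2 replaces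
    the predecessors in [chain_prog] by visible successors. *)
Definition unit_edges L i : seq edge :=
  gadget (L + 3 + i.*2) (OInc, (L + 3 + i.*2).+1, (L + 3 + i.*2).+1)
  ++ gadget (L + 4 + i.*2) (OKeep, (L + i.*2).+1, (L + i.*2).+1).

Lemma unit_onto L i m : pickle_onto (unit_edges L i) m =
  pickle_onto (gadget (L + 3 + i.*2) (OInc, (L + 3 + i.*2).+1, (L + 3 + i.*2).+1))
    (pickle_onto (gadget (L + 4 + i.*2) (OKeep, (L + i.*2).+1, (L + i.*2).+1)) m).
Proof. exact: pickle_onto_cat. Qed.

Definition all_edges L n (tail : seq edge) : seq edge :=
  init0 :: init1 (L + n.*2).+1 :: iteri n (fun i es => unit_edges L i ++ es) tail.

Lemma mem_all_edges P L n e : size P = L.+2 ->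
  (e \in all_edges L n (gadgets P)) =
  (e \in [:: init0; init1 (L + n.*2).+1]) || (e \in gadgets (chain_prog P n)).
Proof.
move=> HP; rewrite -mem_cat cat_cons cat_cons cat0s !in_cons; do 2 congr (_ || _).
elim: n => [//|n IH].
rewrite chain_progS gadgets_cat2 size_chain_prog HP iteriS !mem_cat IH.
rewrite orbC; congr (_ || _).
rewrite (_ : L.+2 + n.*2 + 2 = (L + 3 + n.*2).+1); last lia.
rewrite (_ : (L.+2 + n.*2).+2 = L + 4 + n.*2); last lia.
by rewrite (_ : (L.+2 + n.*2).+1 = L + 3 + n.*2); last lia.
Qed.

(** Two instructions, each under three assignments of the clock roles. *)
Definition price_block : seq int := flatten (nseq 6 price_pattern).
Definition all_prices n (tail : seq int) : seq int := iteri n (fun _ s => price_block ++ s) tail.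

Definition automaton L n (tail : seq edge) (ptail : seq int) : rpta :=
  (5, 63 * (L + n.*2 + 3), 1, [:: 0], all_prices n ptail, all_edges L n tail).

Definition threshold : rat := 76%R.

Lemma pickle_init1 s :
  pickle (init1 s) = pairN (pickle (init1 0).1) (pairN (consN (loc s 0 0) 0) 0).
Proof. by rewrite pickle_pair pickle_inl. Qed.

(* The first counter representing the registers (a, b, d, 0, 0, ...), see [rep]. *)
Definition input_size (a b d : nat) := pr 0 ^ a * pr 1 ^ b * pr 2 ^ d.

Lemma computes_enc : exists2 F, computes 3 F & forall L tail ptail,
  let b := pickle tail in let d := pickle ptail in
  F [:: L; b; d] = enc (automaton L (input_size L b d) tail ptail, 0, threshold).
Proof.
pose N v := input_size (nth 0 v 0) (nth 0 v 1) (nth 0 v 2).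
pose L v := nth 0 v 0.
have HL m : computes m.+1 L by apply: computes_proj.
have HN : computes 3 N.
  rewrite /N /input_size; apply: computes_mul; first apply: computes_mul;
  by apply: computes_exp; apply: computes_proj.
have Hdbl k F : computes k F -> computes k (fun v => (F v).*2).
  by move=> H; apply: computes_ext (computes_add H H) _ => v _; rewrite addnn.
pose E v := iteri (N v) (fun i m => pickle_onto (unit_edges (L v) i) m) (nth 0 v 1).
have HE : computes 3 E.
  pose L2 w := nth 0 w 2; pose I w := nth 0 w 0; pose M w := nth 0 w 1.
  have HL2 : computes 5 L2 by apply: computes_proj.
  have HI : computes 5 (fun w => (I w).*2) by apply: Hdbl; apply: computes_proj.
  have HLk j : computes 5 (fun w => L2 w + j + (I w).*2).
    by apply: computes_add HI; apply: computes_add HL2 _; apply: computes_const.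
  pose S w := pickle_onto (gadget (L2 w + 3 + (I w).*2) (OInc, (L2 w + 3 + (I w).*2).+1, (L2 w + 3 + (I w).*2).+1))
    (pickle_onto (gadget (L2 w + 4 + (I w).*2) (OKeep, (L2 w + (I w).*2).+1, (L2 w + (I w).*2).+1)) (M w)).
  have HS : computes 5 S.
    apply: computes_gadget => //; apply: computes_gadget => //; first exact: computes_add HL2 HI.
    exact: computes_proj.
  apply: computes_ext (computes_iter HN (computes_proj (isT : 1 < 3)) HS) _ => v _.
  apply: eq_iteri => i m; exact/esym/unit_onto.
pose Q v := iteri (N v) (fun _ m => pickle_onto price_block m) (nth 0 v 2).
have HQ : computes 3 Q.
  have HS : computes 5 (fun w => pickle_onto price_block (nth 0 w 1)).
    elim: price_block => [|p s IH] /=; first exact: computes_proj.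
    by apply: computes_cons => //; apply: computes_const.
  by apply: computes_ext (computes_iter HN (computes_proj (isT : 2 < 3)) HS) _.
pose I1 v := pickle (init1 (L v + (N v).*2).+1).
have HI1 : computes 3 I1.
  apply: (@computes_ext _ (fun v => pairN (pickle (init1 0).1) (pairN (consN (loc (L v + (N v).*2).+1 0 0) 0) 0)));
    last by move=> v _; rewrite -pickle_init1.
  apply: computes_pair; first exact: computes_const.
  apply: computes_pair; last exact: computes_const.
  apply: computes_cons; last exact: computes_const.
  by apply: computes_loc; apply: computes_succ; apply: computes_add => //; apply: Hdbl.
pose F v := pairN (pairN (pairN (pairN (pairN (pairN (pairN 5 (63 * (L v + (N v).*2 + 3))) 1)
   (pickle [:: 0])) (Q v)) (consN (pickle init0) (consN (I1 v) (E v)))) 0) (pickle threshold).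
exists F.
  apply: computes_pair; last exact: computes_const.
  apply: computes_pair; last exact: computes_const.
  apply: computes_pair.
    apply: computes_pair => //; apply: computes_pair; last exact: computes_const.
    apply: computes_pair; last exact: computes_const.
    apply: computes_pair; first exact: computes_const.
    apply: computes_mul; first exact: computes_const.
    apply: computes_add; last exact: computes_const.
    by apply: computes_add => //; apply: Hdbl.
  apply: computes_cons; first exact: computes_const.
  exact: computes_cons.
move=> l tail ptail b d; rewrite /F.
have EE : E [:: l; b; d] = pickle (iteri (input_size l b d) (fun i es => unit_edges l i ++ es) tail).
  by rewrite pickle_iteri_cat.
have EQ : Q [:: l; b; d] = pickle (all_prices (input_size l b d) ptail).
  by rewrite /all_prices pickle_iteri_cat.
rewrite EE EQ /I1 /N /L [nth _ _ _]/= [nth _ _ 1]/= [nth _ _ 2]/=.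
by rewrite /enc /automaton !pickle_pair /all_edges !pickle_cons.
Qed.

(** * Diagonalisation *)

(** Jumps must stay inside the program for the automaton to be well formed. *)
Definition bounded m (P : seq instr) : bool :=
  all (fun i : instr => (i.1.2 <= m) && (i.2 <= m)) P.

Lemma bounded_loop_code m body cur top : top <= m -> cur + (size body).*2.+1 <= m ->
  bounded m (loop_code body cur top).
Proof.
move=> Ht; elim: body cur => [|[o1 o2] bd IH] cur /=; first by rewrite /bounded /=; lia.
move=> Hc; rewrite /bounded /= -/(bounded m _) IH; last by move: Hc; clear; lia.
by case: bd Hc {IH} => [|p bd] /= Hc; apply/and3P; split=> //; apply/andP; split; lia.
Qed.

Lemma bounded_test_code m p b lno : lno <= m -> b + p.*2.+2 <= m ->
  bounded m (test_code p b lno).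
Proof.
move=> Hl Hb; rewrite /bounded /test_code all_cat /= !andbT; apply/andP; split; last lia.
rewrite all_map; apply/allP => k; rewrite mem_iota => /andP [_ Hk] /=.
by case: (odd k) => /=; repeat case: ifP => _; apply/andP; split; lia.
Qed.

Lemma emit_loop i s b : exists b1 b2 b3,
  emit (Loop i s) b = test_code (pr i) b (b3 + 2) ++ loop_code (div_body (pr i)) b1 b1
    ++ emit s b2 ++ [:: (OKeep, b3.+1, b3.+1); (OKeep, b, b)] /\
  [/\ b1 = b + (pr i).*2.+2, b2 = b1 + (pr i).*2.+1 & b3 = b2 + size (emit s b2)].
Proof. by do 3 eexists; split; first reflexivity. Qed.

Lemma bounded_emit m s b : b + size (emit s b) <= m -> bounded m (emit s b).
Proof.
elim: s b => [|i|s1 IH1 s2 IH2|i s IH] b.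
- by [].
- move=> H; apply: (@bounded_loop_code m (mul_body (pr i)) b b).
    exact: leq_trans (leq_addr _ _) H.
  by rewrite -(size_loop_code _ b b).
- rewrite /= size_cat => H; rewrite /bounded all_cat; apply/andP; split.
    by apply: IH1; lia.
  by apply: IH2; lia.
- have [b1 [b2 [b3 [-> [Eb1 Eb2 Eb3]]]]] := emit_loop i s b.
  rewrite size_cat size_test_code !size_cat size_loop_code => H.
  have p0 := prime_gt0 (pr_prime i).
  have sz : size (div_body (pr i)) = pr i by rewrite size_rcons size_nseq prednK.
  rewrite sz /= in H.
  rewrite /bounded all_cat; apply/andP; split; first by apply: bounded_test_code; lia.
  rewrite !all_cat; apply/and3P; split.
  + by apply: bounded_loop_code; rewrite ?sz; lia.
  + by apply: IH; lia.
  + by rewrite /=; lia.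
Qed.

Lemma bounded_leq m n P : m <= n -> bounded m P -> bounded n P.
Proof.
move=> mn; apply: sub_all => i /andP [h1 h2].
by rewrite (leq_trans h1) // (leq_trans h2).
Qed.

Lemma bounded_chain_prog P n : 0 < size P -> bounded (size P) P ->
  bounded (size P + n.*2) (chain_prog P n).
Proof.
move=> P0 HP; elim: n => [|n IH]; first by rewrite addn0.
rewrite chain_progS /bounded all_cat; apply/andP; split.
  by apply: bounded_leq IH; lia.
by rewrite /=; lia.
Qed.

Lemma fetch_bounded P pc : bounded (size P) P -> 0 < pc <= size P ->
  ((fetch P pc).1.2 <= size P) && ((fetch P pc).2 <= size P).
Proof. by move=> /all_nthP H Hpc; apply: H; lia. Qed.

Definition tmpl_wf (t : tmpl) : bool :=
  [&& t.1.1.1 < 21, all (fun c : constr => c.1.1 < 5) t.1.1.2,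
      all (fun x => x < 5) t.1.2 & if t.2 is inl t' then t' < 21 else true].

Lemma phase_wf o r : r < 3 -> all tmpl_wf (phase o r).
Proof. by case: r => [|[|[|//]]] _; case: o. Qed.

Lemma loc_lt n pc r t : pc <= n -> r < 3 -> t < 21 -> loc pc r t < 63 * n.+1.
Proof. by rewrite /loc; lia. Qed.

Lemma gadget_wf A n pc i e : nclk A = 5 -> nloc A = 63 * n.+1 -> ntgt A = 1 ->
  pc <= n -> i.1.2 <= n -> i.2 <= n -> e \in gadget pc i -> wf_edge A e.
Proof.
move=> Hk Hl Hn Hpc Hz Hp /gadget_inv [r [t [Hr Ht ->]]].
have /and4P [t1 t2 t3 t4] := allP (phase_wf i.1.1 Hr) t Ht.
have Hgoto q : q <= n -> if goto q ((r + 1) %% 3) is inl l then l < 63 * n.+1 else true.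
  by case: q => // q Hq; apply: loc_lt => //; rewrite ltn_mod.
apply/and4P; rewrite Hk; split=> //.
  by rewrite Hl; apply: loc_lt.
rewrite /e_dst /= Hl Hn; case: t.2 t4 => [t'|[|[|j]]] //= t4.
- exact: loc_lt.
- by have := Hgoto _ Hz; rewrite /goto; case: i.1.2.
- by have := Hgoto _ Hp; rewrite /goto; case: i.2.
Qed.

Definition base_prices n : seq int := flatten (nseq (3 * n.+1) price_pattern).

Lemma all_prices_base n m : all_prices n (base_prices m) = base_prices (m + n.*2).
Proof.
elim: n => [|n IH]; first by rewrite addn0.
rewrite /all_prices iteriS -/(all_prices _ _) IH /base_prices.
rewrite (_ : 3 * (m + n.+1.*2).+1 = 6 + 3 * (m + n.*2).+1); last lia.
by rewrite nseqD flatten_cat.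
Qed.

Lemma size_flatten_price n : size (flatten (nseq n price_pattern)) = 21 * n.
Proof. by elim: n => //= n ->; rewrite mulnS. Qed.

Lemma nth_flatten_price n q t : q < n -> t < 21 ->
  nth 0%R (flatten (nseq n price_pattern)) (q * 21 + t) = nth 0%R price_pattern t.
Proof.
elim: n q => // n IH q Hq Ht.
have -> : flatten (nseq n.+1 price_pattern) =
  price_pattern ++ flatten (nseq n price_pattern) by [].
rewrite nth_cat; have -> : size price_pattern = 21 by [].
case: q Hq => [|q] Hq; first by rewrite mul0n add0n Ht.
have -> : (q.+1 * 21 + t < 21) = false by lia.
by rewrite (_ : q.+1 * 21 + t - 21 = q * 21 + t) ?IH //; lia.
Qed.

Section Automaton.
Variables (P : seq instr) (L n : nat).
Hypothesis HP : size P = L.+2.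
Local Notation A := (automaton L n (gadgets P) (base_prices L.+2)).
Local Notation Q := (chain_prog P n).

Lemma sizeQ : size Q = L.+2 + n.*2.
Proof. by rewrite size_chain_prog HP. Qed.

Lemma automaton_implements : implements A Q (L + n.*2).+1.
Proof.
split=> [e|pc r t Hpc Hr Ht]; first by rewrite -mem_gadgets -(mem_all_edges _ _ HP).
rewrite /eta /prices /automaton /= all_prices_base /base_prices.
rewrite (_ : loc pc r t = (3 * pc + r) * 21 + t); last by rewrite /loc; lia.
by rewrite nth_flatten_price //; rewrite sizeQ in Hpc; lia.
Qed.

Lemma automaton_in_class : bounded (size P) P -> in_class (A, 0, threshold).
Proof.
move=> HB; split=> //.
- have HN : nloc A = 63 * (size Q).+1 by rewrite sizeQ /nloc /=; lia.
  apply/and3P; split.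
  + by rewrite HN /prices /= all_prices_base /base_prices size_flatten_price sizeQ; lia.
  + by rewrite /inits /= HN.
  + apply/allP => e; rewrite (impl_edges automaton_implements) => /orP [|/hasP [pc]].
      have N2 : 1 < nloc A by rewrite HN; lia.
      rewrite in_cons mem_seq1 => /orP [] /eqP ->; apply/and4P; split=> //; first exact: ltnW.
      by rewrite /e_dst HN; apply: loc_lt => //; rewrite sizeQ; lia.
    rewrite mem_iota => Hpc; have Hpc' : 0 < pc <= size Q by lia.
    have HBQ : bounded (size Q) Q.
      by rewrite size_chain_prog; apply: bounded_chain_prog => //; rewrite HP.
    have /andP [Hz Hp] := fetch_bounded HBQ Hpc'.
    by apply: gadget_wf HN _ _ Hz Hp => //; case/andP: Hpc'.
- rewrite /prices /= all_prices_base /base_prices.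
  by elim: (3 * _) => //= k ->.
Qed.

Lemma code_at_chain b ls : code_at P b ls -> code_at Q b ls.
Proof.
move=> H; elim: n => [|m [p [q [E Eb]]]] //; exists p.
rewrite chain_progS E; eexists; split; last exact: Eb.
by rewrite -!catA.
Qed.

(** Execution enters at the last added pair and descends towards the program; [x] counts the pairs
    done and [m] those left. *)
Lemma chain_reach : reach Q ((L + n.*2).+1, 0, 0) (L.+1, n, 0).
Proof.
suff H m x : m <= n -> x + m = n -> reach Q ((L + m.*2).+1, x, 0) (L.+1, n, 0) by apply: H.
elim: m x => [|m IH] x Hm Hx.
  by rewrite addn0 -Hx addn0; exact: reach_refl.
have Hc : code_at Q (L.+2 + m.*2).+1
    [:: (OInc, L.+2 + m.*2 + 2, L.+2 + m.*2 + 2); (OKeep, (L.+2 + m.*2).-1, (L.+2 + m.*2).-1)].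
  have [q ->] : exists q, Q = chain_prog P m.+1 ++ q.
    elim: n Hm => // k IHk; rewrite leq_eqVlt => /orP [/eqP <-|/IHk [q Eq]].
      by exists [::]; rewrite cats0.
    by rewrite [chain_prog P k.+1]chain_progS Eq -catA; eexists.
  by exists (chain_prog P m), q; rewrite chain_progS HP size_chain_prog HP -catA.
rewrite (_ : (L + m.+1.*2).+1 = (L.+2 + m.*2).+1 + 0); last by rewrite addn0; lia.
apply: (code_at_step Hc) => //; rewrite /=.
rewrite (_ : L.+2 + m.*2 + 2 = (L.+2 + m.*2).+1 + 1); last lia.
apply: (code_at_step Hc) => //; rewrite /=.
by apply: IH; lia.
Qed.

End Automaton.

Lemma rep_input a b d : rep (fun i => nth 0 [:: a; b; d] i) (input_size a b d).
Proof.
have p0 i : 0 < pr i := prime_gt0 (pr_prime i).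
have q0 i m : 0 < pr i ^ m by rewrite expn_gt0 p0.
split; first by rewrite !muln_gt0 !q0.
move=> i; rewrite !lognM ?muln_gt0 ?q0 // !lognX !logn_prime ?pr_prime // !pr_inj.
by case: i => [|[|[|i]]] /=; rewrite ?nth_nil; lia.
Qed.

Theorem theorem4 :
  ~ exists c : code, decides_on enc in_class upper_bound_yes c.
Proof.
move=> [c Hdec].
have [F [cF HF] Henc] := computes_enc.
pose S := compile (CComp c [:: cF]) [:: 0; 1; 2] 3 4.
pose b1 := 1 + size (emit S 1).
(* The success exit of the test on register 3, which holds the answer of [c]; its failure exit 0
   halts the machine. *)
pose dead := b1 + (pr 3).*2.+2.
pose body := emit S 1 ++ test_code (pr 3) b1 0 ++ [:: (OKeep, dead, dead)].
pose L := size body.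
(* A landing pair: each start-up pair jumps to the pair before it, the lowest one to [L.+1]. Two
   instructions keep the counters in order. *)
pose P := body ++ [:: (OKeep, L.+2, L.+2); (OKeep, 1, 1)].
have HP : size P = L.+2 by rewrite size_cat addn2.
pose b := pickle (gadgets P); pose d := pickle (base_prices L.+2).
(* [P] does not mention [n], so its own description can be fed to it as input. *)
pose n := input_size L b d.
pose A := automaton L n (gadgets P) (base_prices L.+2).
have Hx : F [:: L; b; d] = enc (A, 0, threshold) by apply: Henc.
have HL : L = dead.
  by rewrite /L /body size_cat (size_cat (test_code _ _ _)) size_test_code /dead /b1 /=; lia.
have HB : bounded (size P) P.
  rewrite HP /bounded /P all_cat; apply/andP; split; last by rewrite /=; lia.
  rewrite /body all_cat; apply/andP; split.
    by apply: bounded_emit; rewrite HL /dead /b1; lia.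
  rewrite all_cat; apply/andP; split; last by rewrite /= HL; lia.
  by apply: bounded_test_code; rewrite HL /dead; lia.
have Hin : in_class (A, 0, threshold) := automaton_in_class n HP HB.
have HA := automaton_implements n HP.
set Q := chain_prog P n in HA.
have C1 : code_at Q 1 (emit S 1).
  apply: code_at_chain; exists [::], (test_code (pr 3) b1 0 ++ [:: (OKeep, dead, dead)] ++ [:: (OKeep, L.+2, L.+2); (OKeep, 1, 1)]).
  by rewrite /P /body -!catA.
have C2 : code_at Q b1 (test_code (pr 3) b1 0).
  apply: code_at_chain; exists (emit S 1), ([:: (OKeep, dead, dead)] ++ [:: (OKeep, L.+2, L.+2); (OKeep, 1, 1)]).
  by rewrite /P /body -!catA /b1 add1n.
have C3 : code_at Q dead [:: (OKeep, dead, dead)].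
  apply: code_at_chain; exists (emit S 1 ++ test_code (pr 3) b1 0), [:: (OKeep, L.+2, L.+2); (OKeep, 1, 1)].
  split; first by rewrite /P /body -!catA.
  by rewrite size_cat size_test_code /dead /b1; lia.
have C4 : code_at Q L.+1 [:: (OKeep, L.+2, L.+2); (OKeep, 1, 1)].
  by apply: code_at_chain; exists body, [::]; rewrite cats0.
have Hrun y : eval c [:: enc (A, 0, threshold)] y -> exists B,
    reach Q ((L + n.*2).+1, 0, 0) (if 0 < y then dead else 0, B, 0).
  move=> Hy; have Hy' : eval (CComp c [:: cF]) [:: L; b; d] y.
    by apply: ev_comp Hy; rewrite -Hx; apply: evs_cons (evs_nil _); apply: HF.
  have Hr := rep_input L b d; set rho := fun i => _ in Hr.
  have HS : exec S rho (upd rho 3 y).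
    apply: (comp_correct Hy') => // i; rewrite /rho.
    by move=> Hi; rewrite nth_default //; apply: ltnW.
  have [B HrB HrunB] := emit_correct HS C1 Hr.
  exists B.
  apply: reach_trans (chain_reach n HP) _.
  rewrite -[L.+1]addn0; apply: (code_at_step C4) => //=.
  rewrite -[L.+2]addn1; apply: (code_at_step C4) => //=; rewrite if_same.
  apply: reach_trans HrunB _; rewrite -/b1 -[b1]addn0.
  have B0 : 0 < B by case: HrB.
  have := test_loop B.-1 0 (prime_gt0 (pr_prime 3)) C2.
  by rewrite prednK // add0n (rep_dvd 3 HrB) upd_same.
have Hratr : ratr threshold = 76%R :> R by rewrite /threshold rmorph_nat.
have [Hyes Hno] := Hdec _ Hin.
(* [decides_on] yields an output of [c] only from a proof of one of the two sides, hence excluded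
   middle. *)
have [Hub|Hub] := classic (upper_bound_yes (A, 0, threshold)).
  have [B /= [k Hk Hvalid]] := Hrun _ (Hyes Hub).
  have Hdead m : exists c1 c2, iter m (mstep Q) (dead, B, 0) = (dead, c1, c2) /\
      valid Q (dead, c1, c2).
    have [Hd Hfetch] := code_at_fetch C3 (isT : 0 < 1); rewrite addn0 in Hd Hfetch.
    have Hv c1 c2 : valid Q (dead, c1, c2) by rewrite /valid Hd Hfetch.
    elim: m => [|m [c1 [c2 [E _]]]]; first by exists B, 0.
    exists c2, c1; split; last exact: Hv.
    by rewrite iterS E /= Hfetch /= if_same.
  case: Hub => s1; rewrite Hratr => Hlim.
  apply: (never_halts_no HA _ Hlim) => j.
  have [jk|kj] := ltnP j k; first exact: Hvalid.
  by rewrite -(subnK kj) iterD Hk; have [c1 [c2 [-> Hv]]] := Hdead (j - k).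
have [B /= [k Hk Hvalid]] := Hrun _ (Hno Hub).
apply: Hub; exists (honest Q (L + n.*2).+1); rewrite Hratr.
by apply: halts_yes HA _ Hvalid _; rewrite ?Hk.
Qed.
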